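(* For $n\ge 2$ let $\mu_n=\mathbb{E}(X_n)$ and $\sigma_n^2=\mathbb{V}(X_n)$ (with $\sigma_n>0$) be the expected value and the variance of the random variable $X_n$. Then the normalized random variables $(X_n-\mu_n)/\sigma_n$ converge in distribution to the standard normal distribution $\Phi$, and $$\lim_{n\to\infty}\ \sup_{x\in\mathbb{R}}\left|\frac{1}{\sum_{m=0}^n A_{n,m}}\sum_{\substack{0\le k\le n\\ k\le \mu_n+\sigma_n x}}A_{n,k}-\Phi(x)\right|=0 .$$
   Context: The polynomials $Q_n(x)$ are defined by $Q_0(x)=1$ and $Q_n(x)=x\sum_{k=1}^n k\,Q_{n-k}(x)$ for $n\ge 1$. The numbers $A_{n,k}$ are their coefficients: $Q_n(x)=\sum_{k=0}^n A_{n,k}x^k$. For $n\ge1$ and $0\le k\le n$ one has $A_{n,k}=\binom{n+k-1}{2k-1}$, with $A_{n,0}=0$. For $n\ge1$, $X_n$ is a random variable with values in $\{0,1,\dots,n\}$ and $P(X_n=k)=A_{n,k}/\sum_{m=0}^n A_{n,m}$. The function $\Phi(x)=\frac{1}{\sqrt{2\pi}}\int_{-\infty}^x e^{-t^2/2}\,dt$ is the standard normal distribution function. *)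

(* Defs.v *)
From HB Require Import structures.
From mathcomp Require Import all_boot all_order all_algebra.
From mathcomp Require Import all_classical all_reals all_analysis.
From mathcomp Require Import measurable_realfun.

Set Implicit Arguments.
Unset Strict Implicit.
Unset Printing Implicit Defensive.

Import Order.TTheory GRing.Theory Num.Theory.
Import numFieldNormedType.Exports.

Local Open Scope classical_set_scope.
Local Open Scope ring_scope.

(* [Qhist R n] is the list [:: Q_n; Q_(n-1); ...; Q_0], so that in the
   successor case, where n = m.+1, the entry of index k.-1 is Q_(n-k). *)
Fixpoint Qhist (R : nzRingType) (n : nat) : seq {poly R} :=
  if n is m.+1 then
    ('X * \sum_(1 <= k < m.+2) ((Qhist R m)`_k.-1 *+ k)) :: Qhist R m
  else [:: 1].

Definition Q (R : nzRingType) (n : nat) : {poly R} := (Qhist R n)`_0.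

Lemma nth_Qhist (R : nzRingType) (n i : nat) :
  (i <= n)%N -> (Qhist R n)`_i = Q R (n - i).
Proof.
elim: n i => [|n IHn] [|i] //= lein.
by rewrite IHn// subSS.
Qed.

Lemma Q0 (R : nzRingType) : Q R 0 = 1.
Proof. by []. Qed.

Lemma Q_rec (R : nzRingType) (n : nat) : (1 <= n)%N ->
  Q R n = 'X * \sum_(1 <= k < n.+1) (Q R (n - k) *+ k).
Proof.
case: n => // n _; rewrite {1}/Q /=; congr (_ * _).
apply: eq_big_nat => -[//|k] /andP[_ ltkn].
by rewrite nth_Qhist// subSS.
Qed.

Definition A (R : nzRingType) (n k : nat) : R := (Q R n)`_k.

Definition sumA (R : nzRingType) (n : nat) : R := \sum_(m < n.+1) A R n m.

Definition has_law_A (R : realType) (n : nat) (d : measure_display)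
    (T : measurableType d) (P : probability T R) (X : {RV P >-> R}) : Prop :=
  (forall w : T, exists2 k : nat, (k <= n)%N & X w = k%:R) /\
  (forall k : nat, (k <= n)%N ->
     P (X @^-1` [set k%:R]) = (A R n k / sumA R n)%:E).

Definition mean (R : realType) (d : measure_display) (T : measurableType d)
  (P : probability T R) (X : {RV P >-> R}) : R := fine 'E_P[X].

Definition stddev (R : realType) (d : measure_display) (T : measurableType d)
  (P : probability T R) (X : {RV P >-> R}) : R := Num.sqrt (fine 'V_P[X]).

Definition normalized (R : realType) (d : measure_display)
    (T : measurableType d) (P : probability T R) (X : {RV P >-> R}) : T -> R :=
  fun w => (X w - mean X) / stddev X.

Lemma measurable_normalized (R : realType) (d : measure_display)
    (T : measurableType d) (P : probability T R) (X : {RV P >-> R}) :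
  measurable_fun setT (normalized X).
Proof.
by apply: measurable_funM => //; apply: measurable_funB.
Qed.

HB.instance Definition _ (R : realType) (d : measure_display)
    (T : measurableType d) (P : probability T R) (X : {RV P >-> R}) :=
  isMeasurableFun.Build _ _ _ _ (normalized X) (measurable_normalized X).

(* F is the distribution function of the limit law; the random variables may
   live on different probability spaces. *)
Definition cvg_in_distribution (R : realType) (d : nat -> measure_display)
    (T : forall n, measurableType (d n)) (P : forall n, probability (T n) R)
    (Y : forall n, {RV (P n) >-> R}) (F : R -> R) : Prop :=
  forall x : R, {for x, continuous F} ->
    cdf (Y n) x @[n --> \oo] --> (F x)%:E.

Definition Phi (R : realType) (x : R) : R :=
  (Num.sqrt (2 * pi))^-1 *
  \int[lebesgue_measure]_(t in `]-oo, x]) expR (- t ^+ 2 / 2).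

Lemma PhiE (R : realType) (x : R) : (Phi x)%:E = normal_prob (0:R) 1 `]-oo, x].
Proof.
have i : lebesgue_measure.-integrable `]-oo, x]
    (fun t => (normal_pdf (0:R) 1 t)%:E).
  by apply: (integrableS measurableT) => //; exact: integrable_normal_pdf.
rewrite /Phi /normal_prob.
have -> : (fun t : R => expR (- t ^+ 2 / 2)) =
    (fun t => (normal_peak 1)^-1 * normal_pdf (0:R) 1 t).
  apply/funext => t; rewrite normal_pdfE ?oner_eq0// mulrA.
  rewrite mulVf ?gt_eqF ?normal_peak_gt0 ?oner_eq0//.
  by rewrite /normal_fun mul1r subr0 expr1n.
rewrite RintegralZl// mulrA /normal_peak expr1n mul1r invrK mulr_natl mulVf ?mul1r.
  by rewrite /Rintegral fineK//; exact: integrable_fin_num.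
by rewrite gt_eqF// sqrtr_gt0 mulrn_wgt0// pi_gt0.
Qed.

(* Main.v *)
Require Import Defs.
From HB Require Import structures.
From mathcomp Require Import all_boot all_order all_algebra.
From mathcomp Require Import all_classical all_reals all_analysis.
From mathcomp Require Import measurable_realfun ring lra zify.

Set Implicit Arguments.
Unset Strict Implicit.
Unset Printing Implicit Defensive.

Import Order.TTheory GRing.Theory Num.Theory.
Import numFieldNormedType.Exports.

Local Open Scope classical_set_scope.
Local Open Scope ring_scope.

(** Why the theorem is true.  The closed form A(n,k) = C(n+k-1, 2k-1) makes the
    quotient of consecutive coefficients a rational function:
      A(n,k+1) / A(n,k) = (n^2 - k^2) / (2k (2k+1)),
    which crosses 1 near k = n / sqrt 5.  Write x = k - n / sqrt 5.  To first
    order the logarithm of the quotient is - (5 sqrt 5 / 2) x / n, so summing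
    from the peak gives
      A(n,k) / A(n,peak) ~ exp (- x^2 / (2 s^2)),  s^2 = 2 n / (5 sqrt 5),
    with an error that vanishes when x = O(s) ([ln_A_local]), together with a
    cruder bound of Gaussian shape valid for all k ([ln_A_le]).

    This local statement is turned into the limit theorem by dominated
    convergence.  Up to the factor 1/s, a sum over k is the integral of the step
    function t |-> value at floor (peak + s t); these step functions converge
    pointwise to exp (- t^2 / 2) times the limit of the summand, under a Gaussian
    bound ([gaussian_array_sum_cvg]).  Taking as summands 1, the standardized
    position z = (k - peak) / s, z^2, and the indicator of k <= mu + sigma y,
    one obtains the total mass, the mean (mu - peak = o(s)), the variance
    (sigma / s -> 1) and the distribution function (limit Phi y) all from the
    same lemma: the first three sums determine mu and sigma up to o(s), which is
    what the convergence of the fourth summand requires.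

    The convergence of the distribution functions is pointwise; it is uniform
    because they are monotone and the limit is a continuous distribution
    function ([polya]). *)

(** * Coefficients of Q_n *)

Lemma A0 (R : nzRingType) (n : nat) : A R n 0 = (n == 0)%:R.
Proof.
case: n => [|n]; first by rewrite /A Q0 coef1.
by rewrite /A Q_rec// coefXM.
Qed.

Lemma Q_convolution (R : nzRingType) (n : nat) : (0 < n)%N ->
  Q R n = 'X * \sum_(j < n) (Q R j *+ (n - j)).
Proof.
move=> n0; rewrite Q_rec// big_add1 /= big_mkord; congr (_ * _).
rewrite (reindex_inj rev_ord_inj) /=; apply: eq_bigr => i _.
by rewrite subnSK// subKn// ltnW.
Qed.

(** The weights n - j are affine in n, so the second difference in n of the
    convolution is local; this is what reduces the full-history recurrence of
    Q_n to a three-term one. *)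
Lemma convolution_second_difference (V : zmodType) (f : nat -> V) (n : nat) :
  \sum_(j < n.+2) (f j *+ (n.+2 - j)) + \sum_(j < n) (f j *+ (n - j)) =
  (\sum_(j < n.+1) (f j *+ (n.+1 - j))) *+ 2 + f n.+1.
Proof.
have diff p : \sum_(j < p.+1) (f j *+ (p.+1 - j)) =
    \sum_(j < p) (f j *+ (p - j)) + \sum_(j < p.+1) f j.
  rewrite big_ord_recr /= subSnn mulr1n [in RHS]big_ord_recr /= addrA.
  rewrite -big_split /=; congr (_ + _); apply: eq_bigr => j _.
  by rewrite subSn ?mulrSr// ltnW.
rewrite (diff n.+1) (big_ord_recr n.+1) /= mulr2n {3}(diff n).
by rewrite -!addrA; congr (_ + _); rewrite [RHS]addrCA [f _ + _]addrC.
Qed.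

(** This is Q_(n+2) - 2 Q_(n+1) + Q_n = x Q_(n+1) read on coefficients.  As an
    identity of polynomials it fails for n = 0, but only in degree 0, hence the
    index k.+1. *)
Lemma A_three_term (R : nzRingType) (n k : nat) :
  A R n.+2 k.+1 + A R n k.+1 = A R n.+1 k.+1 *+ 2 + A R n.+1 k.
Proof.
have AE p : A R p k.+1 = (\sum_(j < p) (Q R j *+ (p - j)))`_k.
  case: p => [|p]; first by rewrite big_ord0 coef0 /A Q0 coef1.
  by rewrite /A Q_convolution// coefXM.
by rewrite !AE -coefD convolution_second_difference coefD coefMn.
Qed.

(** Both sides satisfy the same three-term recurrence: for the binomials it is
    Pascal's rule applied twice. *)
Lemma A_binomial (R : nzRingType) (n k : nat) :
  A R n k.+1 = 'C(n + k, k.*2.+1)%:R.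
Proof.
(* Two consecutive n are carried along since the recurrence has order two. *)
have [] : A R n k.+1 = 'C(n + k, k.*2.+1)%:R /\
          A R n.+1 k.+1 = 'C(n.+1 + k, k.*2.+1)%:R; last by [].
elim: n k => [|n IHn] k.
  split; first by rewrite /A Q0 coef1 add0n bin_small// ltnS -addnn leq_addr.
  rewrite /A Q_convolution// coefXM big_ord1 Q0 subn0 mulr1n coef1 add1n.
  by case: k => // k; rewrite bin_small//; lia.
split; first exact: (IHn k).2.
apply: (addIr (A R n k.+1)); rewrite A_three_term (IHn k).1 (IHn k).2.
case: k => [|k].
  by rewrite A0 addr0 double0 !addn0 !bin1 -mulrnA -natrD; congr _%:R; lia.
rewrite (IHn k).2 -mulrnA -!natrD; congr _%:R.
rewrite !addnS !addSn doubleS !binS; lia.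
Qed.

Lemma A_ge0 (R : numDomainType) (n k : nat) : 0 <= A R n k.
Proof. by case: k => [|k]; rewrite ?A0 ?A_binomial ler0n. Qed.

Lemma A_gt0 (R : numDomainType) (n k : nat) : (0 < k <= n)%N -> 0 < A R n k.
Proof. by case: k => // k kn; rewrite A_binomial ltr0n bin_gt0; lia. Qed.

Lemma A_gt_eq0 (R : nzRingType) (n k : nat) : (n < k)%N -> A R n k = 0.
Proof. by case: k => // k kn; rewrite A_binomial bin_small//; lia. Qed.

(** The quotient A(n,k+1) / A(n,k) with denominators cleared, so that it also
    covers k >= n. *)
Lemma A_ratio (R : comNzRingType) (n k : nat) : (0 < k)%N ->
  A R n k.+1 * (k%:R * 2 * (k%:R * 2 + 1)) = A R n k * (n%:R ^+ 2 - k%:R ^+ 2).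
Proof.
case: k => // k _; have [nk|kn] := ltnP n k.+1.
  by rewrite !A_gt_eq0 ?mul0r// ltnW.
have binE : ('C(n + k.+1, k.+1.*2.+1) * (k.+1 * 2 * (k.+1 * 2 + 1)) =
    'C(n + k, k.*2.+1) * ((n + k.+1) * (n - k.+1)))%N.
  have e1 := mul_bin_diag (n + k).+1 k.*2.+2; rewrite /= in e1.
  have e2 := mul_bin_left (n + k) k.*2.+1.
  rewrite addnS doubleS; have -> : (k.+1 * 2 + 1 = k.*2.+3)%N by lia.
  have -> : (k.+1 * 2 = k.*2.+2)%N by lia.
  rewrite mulnCA [X in (_ * X)%N = _]mulnC -e1.
  rewrite [LHS]mulnCA e2.
  have -> : (n + k - k.*2.+1 = n - k.+1)%N by lia.
  by ring.
rewrite !A_binomial.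
have -> : n%:R ^+ 2 - k.+1%:R ^+ 2 = ((n + k.+1) * (n - k.+1))%:R :> R.
  by rewrite natrM natrD natrB//; ring.
rewrite -[RHS]natrM -binE !natrM natrD natrM; ring.
Qed.

(** * Logarithmic increments of the coefficients *)

(** With the next lemma, the two halves of 1 - 1/r <= ln r <= r - 1.  For the
    rational quotient r at hand both bounds are rational, which turns every estimate
    of the logarithm into a polynomial inequality. *)
Lemma ln_increment_le (R : realType) (a b : R) : 0 < a -> 0 < b ->
  ln b - ln a <= (b - a) / a.
Proof.
move=> a0 b0; rewrite -ln_div ?posrE//.
have -> : (b - a) / a = b / a - 1 by field; rewrite gt_eqF.
rewrite lerBrDl; have := expR_ge1Dx (ln (b / a)).
by rewrite lnK// posrE divr_gt0.
Qed.

Lemma ln_increment_ge (R : realType) (a b : R) : 0 < a -> 0 < b ->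
  (b - a) / b <= ln b - ln a.
Proof.
move=> a0 b0; rewrite -lerN2 -mulNr !opprB; exact: ln_increment_le.
Qed.

Lemma A_increment_le (R : realType) (n k : nat) : (0 < k < n)%N ->
  ln (A R n k.+1) - ln (A R n k) <=
  (n%:R ^+ 2 - 5 * k%:R ^+ 2 - 2 * k%:R) / (4 * k%:R ^+ 2 + 2 * k%:R).
Proof.
move=> /andP[k0 kn].
have a0 : 0 < A R n k by apply: A_gt0; lia.
have b0 : 0 < A R n k.+1 by apply: A_gt0; lia.
have x0 : 0 < k%:R :> R by rewrite ltr0n.
apply: le_trans (ln_increment_le a0 b0) _; rewrite le_eqVlt; apply/orP; left.
rewrite eqr_div ?lt0r_neq0//; first last.
  by nra.
by have := A_ratio R n k0; move: (A R n k.+1) (A R n k) => b a e; apply/eqP; nra.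
Qed.

Lemma A_increment_ge (R : realType) (n k : nat) : (0 < k < n)%N ->
  (n%:R ^+ 2 - 5 * k%:R ^+ 2 - 2 * k%:R) / (n%:R ^+ 2 - k%:R ^+ 2) <=
  ln (A R n k.+1) - ln (A R n k).
Proof.
move=> /andP[k0 kn].
have a0 : 0 < A R n k by apply: A_gt0; lia.
have b0 : 0 < A R n k.+1 by apply: A_gt0; lia.
have x0 : 0 < k%:R :> R by rewrite ltr0n.
have xn : k%:R < n%:R :> R by rewrite ltr_nat.
apply: le_trans (ln_increment_ge a0 b0); rewrite le_eqVlt; apply/orP; left.
rewrite eqr_div ?lt0r_neq0//; first last.
  by nra.
by have := A_ratio R n k0; move: (A R n k.+1) (A R n k) => b a e; apply/eqP; nra.
Qed.

Lemma ratio_bounds (R : realFieldType) (K y d a b : R) :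
  0 < d -> d <= b -> `|a| <= K * y -> 0 <= K * y -> `|a / b| <= K * y / d.
Proof.
move=> d0 db aK K0; have b0 : 0 < b by apply: lt_le_trans db.
rewrite normrM normfV (gtr0_norm b0).
by apply: ler_pM => //; [rewrite invr_ge0 ltW|rewrite lef_pV2 ?posrE].
Qed.

(** The increments of ln A lie between P / (n^2 - k^2) and P / (4k^2 + 2k).
    Adding the expected drift 5 q x / (2 n) to either and clearing denominators
    must leave O(n (n + x^2)), that is O(n^2) for x of order sqrt n, where the
    two terms separately are of order n^2 x.  They do cancel to leading order,
    which becomes visible in the variable e = n - q k, where q^2 = 5 gives n^2 = 5 k^2 + 2 q k e + e^2 and
    e = t - q x with t bounded. *)
Lemma drift_numerators (R : realFieldType) (q n k m x t e y : R) :
  q ^+ 2 = 5 -> 2 <= q <= 3 -> 0 <= t <= 3 -> 1 <= n ->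
  x = k - m -> t = n - q * m -> e = n - q * k ->
  0 <= k <= n -> - n <= e <= n -> - n <= x <= n ->
  e ^+ 2 <= 20 * y -> x ^+ 2 <= y -> n <= y ->
  let P := n ^+ 2 - 5 * k ^+ 2 - 2 * k in
  `|2 * n * P + 5 * q * x * (4 * k ^+ 2 + 2 * k)| <= 2000 * (n * y) /\
  `|2 * n * P + 5 * q * x * (n ^+ 2 - k ^+ 2)| <= 2000 * (n * y).
Proof.
move=> q5 qb tb n1 xE tE eE kb eb xb ey xy ny /=.
have ext : e = t - q * x by rewrite eE tE xE; ring.
have nE : n = q * k + e by rewrite eE; ring.
have ny0 : n ^+ 2 <= n * y by nra.
have k2 : 0 <= k ^+ 2 <= n ^+ 2 by nra.
have T1 : 0 <= k ^+ 2 * t <= 3 * (n * y) by nra.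
have T2 : 0 <= q * k ^+ 2 <= 3 * (n * y) by nra.
have e2 : 0 <= e ^+ 2 by exact: sqr_ge0.
have x2 : 0 <= x ^+ 2 by exact: sqr_ge0.
have ke2 : 0 <= k * e ^+ 2 <= 20 * (n * y) by nra.
have T3 : 0 <= q * (k * e ^+ 2) <= 60 * (n * y) by nra.
have T4 : - (20 * (n * y)) <= e * e ^+ 2 <= 20 * (n * y) by nra.
have T5 : - (n * y) <= k * e <= n * y by nra.
have kx : - (n * y) <= k * x <= n * y by nra.
have T6 : - (3 * (n * y)) <= q * (k * x) <= 3 * (n * y) by nra.
have xe : - (11 * y) <= x * e <= 11 * y by nra.
have T7 : - (11 * (n * y)) <= k * (x * e) <= 11 * (n * y) by nra.
have exe : - (11 * (n * y)) <= e * (x * e) <= 11 * (n * y) by nra.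
have T8 : - (33 * (n * y)) <= q * (e * (x * e)) <= 33 * (n * y) by nra.
have E1 : 2 * n * (n ^+ 2 - 5 * k ^+ 2 - 2 * k) =
    20 * (k ^+ 2 * t) - 20 * (q * x * k ^+ 2) - 4 * (q * k ^+ 2) +
    6 * (q * (k * e ^+ 2)) + 2 * (e * e ^+ 2) - 4 * (k * e).
  have -> : t = e + q * x by rewrite ext; ring.
  rewrite nE.
  have -> : (q * k + e) ^+ 2 = 5 * k ^+ 2 + 2 * q * k * e + e ^+ 2.
    by rewrite -q5; ring.
  have -> : 20 * (k ^+ 2 * (e + q * x)) =
      4 * q ^+ 2 * (k ^+ 2 * e) + 20 * (k ^+ 2 * (q * x)) by rewrite q5; ring.
  by ring.
have E2 : 5 * q * x * (n ^+ 2 - k ^+ 2) = 20 * (q * x * k ^+ 2) +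
    50 * (k * (x * e)) + 5 * (q * (e * (x * e))).
  have -> : n ^+ 2 = 5 * k ^+ 2 + 2 * q * k * e + e ^+ 2.
    by rewrite nE -q5; ring.
  have -> : 50 * (k * (x * e)) = 10 * q ^+ 2 * (k * (x * e)) by rewrite q5; ring.
  by ring.
split; rewrite ler_norml.
  by rewrite E1; apply/andP; split; lra.
by rewrite E1 E2; apply/andP; split; lra.
Qed.

(** * The peak of the coefficients *)

Definition sqrt5 (R : realType) : R := Num.sqrt 5.

Definition peak (R : realType) (n : nat) : nat := Num.truncn (n%:R / sqrt5 R).

Lemma sqrt5_sqr (R : realType) : sqrt5 R ^+ 2 = 5.
Proof. by rewrite sqr_sqrtr. Qed.

Lemma sqrt5_bounds (R : realType) : 22 / 10 <= sqrt5 R <= 23 / 10.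
Proof.
have := sqrt5_sqr R; have : 0 <= sqrt5 R by rewrite sqrtr_ge0.
by move: (sqrt5 R) => q q0 q5; apply/andP; split; nra.
Qed.

(** The peak is n / sqrt 5 rounded down; the rounding error stays bounded. *)
Lemma peak_itv (R : realType) (n : nat) :
  0 <= n%:R - sqrt5 R * (peak R n)%:R <= sqrt5 R.
Proof.
have /andP[ql _] := sqrt5_bounds R.
have q0 : 0 < sqrt5 R by apply: lt_le_trans ql; lra.
have nq0 : 0 <= n%:R / sqrt5 R by rewrite divr_ge0// ltW.
have /andP[] := truncn_itv nq0; rewrite -/(peak R n).
rewrite ler_pdivlMr// ltr_pdivrMr// => h1 h2.
move: h2; rewrite -natr1 => h2.
by apply/andP; split; nra.
Qed.

Lemma peak_bounds (R : realType) (n : nat) : (100 <= n)%N ->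
  n%:R / 3 <= (peak R n)%:R :> R /\ (peak R n)%:R <= 46 / 100 * n%:R :> R.
Proof.
move=> n100; have : 100 <= n%:R :> R by rewrite ler_nat.
have /andP[ql qu] := sqrt5_bounds R; have /andP[pl pu] := peak_itv R n.
move: (n%:R : R) (_%:R : R) (sqrt5 R) ql qu pl pu => N m q ql qu pl pu N100.
by split; nra.
Qed.

Lemma telescope_le (R : numDomainType) (f : nat -> R) (e : R) (a b : nat) :
  (a <= b)%N -> (forall j, (a <= j < b)%N -> f j.+1 - f j <= e) ->
  f b - f a <= e * (b%:R - a%:R).
Proof.
move=> ab fe; rewrite -telescope_sumr// -natrB// mulr_natr -sumr_const_nat.
by rewrite !big_nat; apply: ler_sum.
Qed.

Lemma telescope_norm (R : realDomainType) (f : nat -> R) (e : R) (a b : nat) :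
  (a <= b)%N -> (forall j, (a <= j < b)%N -> `|f j.+1 - f j| <= e) ->
  `|f b - f a| <= e * (b%:R - a%:R).
Proof.
move=> ab fe; rewrite ler_norml; apply/andP; split; last first.
  by apply: telescope_le => // j /fe; apply: le_trans; exact: ler_norm.
rewrite lerNl opprB.
rewrite -[f a]opprK addrC.
apply: (@telescope_le _ (fun j => - f j)) => // j /fe.
by rewrite -opprD -normrN; apply: le_trans; exact: ler_norm.
Qed.

(** For k between n/5 and 3n/5 the cleared denominators are of order n^3. *)
Lemma drift_bounds (R : realFieldType) (q N K x : R) :
  let P := N ^+ 2 - 5 * K ^+ 2 - 2 * K in
  let y := N + x ^+ 2 in
  100 <= N -> 2 / 10 * N <= K -> K <= 6 / 10 * N ->
  `|2 * N * P + 5 * q * x * (4 * K ^+ 2 + 2 * K)| <= 2000 * (N * y) ->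
  `|2 * N * P + 5 * q * x * (N ^+ 2 - K ^+ 2)| <= 2000 * (N * y) ->
  `|P / (N ^+ 2 - K ^+ 2) + 5 * q / 2 * x / N| <= 8000 * y / N ^+ 2 /\
  `|P / (4 * K ^+ 2 + 2 * K) + 5 * q / 2 * x / N| <= 8000 * y / N ^+ 2.
Proof.
move=> P y n1 kl ku; have x2 : 0 <= x ^+ 2 by exact: sqr_ge0.
have y0 : 0 <= 2000 * (N * y) by rewrite /y; nra.
clearbody y P.
have N3 : 0 < N ^+ 3 by apply: exprn_gt0; lra.
have d1 : N ^+ 3 / 4 <= 2 * N * (4 * K ^+ 2 + 2 * K).
  have : N ^+ 2 / 8 <= 4 * K ^+ 2 + 2 * K by nra.
  rewrite exprS; nra.
have d2 : N ^+ 3 / 4 <= 2 * N * (N ^+ 2 - K ^+ 2).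
  have : N ^+ 2 / 8 <= N ^+ 2 - K ^+ 2 by nra.
  rewrite exprS; nra.
have N34 : 0 < N ^+ 3 / 4 by lra.
have nz1 : 4 * K ^+ 2 + 2 * K != 0 by apply: lt0r_neq0; nra.
have nz2 : N ^+ 2 - K ^+ 2 != 0 by apply: lt0r_neq0; nra.
have nz3 : N != 0 by apply: lt0r_neq0; lra.
move=> N1 N2.
have := ratio_bounds N34 d1 N1 y0; have := ratio_bounds N34 d2 N2 y0.
have -> : 2000 * (N * y) / (N ^+ 3 / 4) = 8000 * y / N ^+ 2.
  by field.
have -> : (2 * N * P + 5 * q * x * (N ^+ 2 - K ^+ 2)) / (2 * N * (N ^+ 2 - K ^+ 2))
  = P / (N ^+ 2 - K ^+ 2) + 5 * q / 2 * x / N.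
  move: (N ^+ 2 - K ^+ 2) nz2 => D D0.
  by field; rewrite nz3.
have -> : (2 * N * P + 5 * q * x * (4 * K ^+ 2 + 2 * K)) / (2 * N * (4 * K ^+ 2 + 2 * K))
  = P / (4 * K ^+ 2 + 2 * K) + 5 * q / 2 * x / N.
  move: (4 * K ^+ 2 + 2 * K) nz1 => D D0.
  by field; rewrite nz3.
by split.
Qed.

(** The constants here and below are far from optimal; only their independence
    of n and k matters. *)
Lemma A_increment_local (R : realType) (n k : nat) :
  let x : R := k%:R - (peak R n)%:R in
  (100 <= n)%N -> (k < n)%N -> `|x| <= n%:R / 8 ->
  `|ln (A R n k.+1) - ln (A R n k) + 5 * sqrt5 R / 2 * x / n%:R| <=
  8000 * (n%:R + x ^+ 2) / n%:R ^+ 2.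
Proof.
move=> x n100 kn; rewrite ler_norml => /andP[xl xu].
have n1 : 100 <= n%:R :> R by rewrite ler_nat.
have /andP[ql qu] := sqrt5_bounds R; have /andP[tl tu] := peak_itv R n.
have [ml mu] := peak_bounds R n100.
have kl : 2 / 10 * n%:R <= k%:R :> R by rewrite /x in xl; lra.
have ku : k%:R <= 6 / 10 * n%:R :> R by rewrite /x in xu; lra.
have k0 : (0 < k)%N by rewrite -(ltr_nat R); lra.
have k0n : (0 < k < n)%N by rewrite k0.
have x2 : 0 <= x ^+ 2 by exact: sqr_ge0.
have [] := @drift_numerators R (sqrt5 R) n%:R k%:R (peak R n)%:R x
  (n%:R - sqrt5 R * (peak R n)%:R) (n%:R - sqrt5 R * k%:R) (n%:R + x ^+ 2).
- exact: sqrt5_sqr.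
- by apply/andP; split; lra.
- by apply/andP; split; lra.
- lra.
- by [].
- by [].
- by [].
- by apply/andP; split; lra.
- by apply/andP; split; nra.
- by apply/andP; split; lra.
- have -> : n%:R - sqrt5 R * k%:R =
    (n%:R - sqrt5 R * (peak R n)%:R) - sqrt5 R * x by rewrite /x; ring.
  have := sqrt5_sqr R; move: (n%:R - sqrt5 R * (peak R n)%:R) tl tu => t tl tu q5.
  have : (t - sqrt5 R * x) ^+ 2 <= 2 * t ^+ 2 + 2 * (5 * x ^+ 2).
    by rewrite -q5; have := sqr_ge0 (t + sqrt5 R * x); lra.
  have : t ^+ 2 <= 6 by nra.
  lra.
- by rewrite lerDr; lra.
- by rewrite lerDl.
move=> N1 N2; have [] := drift_bounds n1 kl ku N1 N2.
have := A_increment_le R k0n; have := A_increment_ge R k0n.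
set r := ln _ - _; move: (_ / _) (_ / _) (_ / _) (_ / _ * x / _).
move=> p1 p2 e d hl hu; rewrite !ler_norml => /andP[h1 h2] /andP[h3 h4].
by apply/andP; split; lra.
Qed.

(** Summing the increments from the peak to k; the quadratic term is the sum of
    the linear drift. *)
Lemma ln_A_local (R : realType) (n k : nat) :
  let x : R := k%:R - (peak R n)%:R in
  (100 <= n)%N -> `|x| <= n%:R / 8 ->
  `|ln (A R n k) - ln (A R n (peak R n)) + 5 * sqrt5 R / 4 * x ^+ 2 / n%:R| <=
  8003 * (n%:R + x ^+ 2) / n%:R ^+ 2 * `|x|.
Proof.
move=> x n100 xn; set m := peak R n.
have n1 : 100 <= n%:R :> R by rewrite ler_nat.
have /andP[ql qu] := sqrt5_bounds R; have [ml mu] := peak_bounds R n100.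
pose f (j : nat) : R :=
  ln (A R n j) + 5 * sqrt5 R / 4 * (j%:R - m%:R) ^+ 2 / n%:R.
have step (j : nat) : `|j%:R - m%:R| <= `|x| -> `|f j.+1 - f j| <=
    8003 * (n%:R + x ^+ 2) / n%:R ^+ 2.
  move=> jx; have jn8 := le_trans jx xn.
  have jn : (j < n)%N.
    move: jn8; rewrite ler_norml => /andP[_ ju].
    by rewrite -(ltr_nat R); rewrite -/m in mu; lra.
  have := A_increment_local n100 jn jn8; rewrite -/m.
  have -> : f j.+1 - f j = ln (A R n j.+1) - ln (A R n j) +
      5 * sqrt5 R / 2 * (j%:R - m%:R) / n%:R + 5 * sqrt5 R / 4 / n%:R.
    by rewrite /f -natr1; field; apply: lt0r_neq0; lra.
  move=> h; apply: le_trans (ler_normD _ _) _.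
  have jx2 : (j%:R - m%:R) ^+ 2 <= x ^+ 2.
    by rewrite -real_normK ?num_real// -[leRHS]real_normK ?num_real// lerXn2r ?nnegrE.
  have c3 : `|5 * sqrt5 R / 4 / n%:R| <= 3 * (n%:R + x ^+ 2) / n%:R ^+ 2.
    rewrite ger0_norm; last by rewrite !mulr_ge0 ?invr_ge0//; lra.
    have -> : 3 * (n%:R + x ^+ 2) / n%:R ^+ 2 =
        3 * (1 + x ^+ 2 / n%:R) / n%:R :> R.
      by field; apply: lt0r_neq0; lra.
    rewrite ler_pM2r ?invr_gt0; last lra.
    have : 0 <= x ^+ 2 / n%:R by rewrite mulr_ge0 ?sqr_ge0 ?invr_ge0//; lra.
    lra.
  have h' : 8000 * (n%:R + (j%:R - m%:R) ^+ 2) / n%:R ^+ 2 <=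
      8000 * (n%:R + x ^+ 2) / n%:R ^+ 2.
    by rewrite ler_pM2r ?invr_gt0 ?exprn_gt0//; lra.
  apply: le_trans (lerD (le_trans h h') c3) _.
  by rewrite le_eqVlt; apply/orP; left; apply/eqP; ring.
have -> : ln (A R n k) - ln (A R n m) + 5 * sqrt5 R / 4 * x ^+ 2 / n%:R =
    f k - f m by rewrite /f /x subrr expr0n /= mulr0 mul0r addr0 addrAC.
have [mk|km] := leqP m k.
  have xE : `|x| = k%:R - m%:R by rewrite ger0_norm// subr_ge0 ler_nat.
  rewrite xE; apply: telescope_norm => // j /andP[mj jk]; apply: step.
  by rewrite xE ger0_norm ?subr_ge0 ?ler_nat// lerD2r ler_nat ltnW.
have xE : `|x| = m%:R - k%:R by rewrite distrC ger0_norm// subr_ge0 ler_nat ltnW.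
rewrite xE -normrN opprB; apply: telescope_norm => [|j /andP[kj jm]].
  exact: ltnW.
apply: step; rewrite xE distrC ger0_norm ?subr_ge0 ?ler_nat//; last exact: ltnW.
by rewrite lerD2l lerN2 ler_nat.
Qed.

(** To the right of the peak ln r <= r - 1 is at most - (5/6) x / n up to
    O(1/n), to the left 1 - 1/r is at least (5/3) |x| / n up to O(1/n).  Both
    exceed |x| / (2 n), the slope of x^2 / (4 n), so ln A + x^2 / (4 n) rises by
    O(1/n) at each of the at most n steps leading away from the peak. *)
Lemma ln_A_le (R : realType) (n k : nat) : (100 <= n)%N -> (0 < k <= n)%N ->
  ln (A R n k) - ln (A R n (peak R n)) <=
  13 - (k%:R - (peak R n)%:R) ^+ 2 / (4 * n%:R).
Proof.
move=> n100 /andP[k0 kn]; set m := peak R n.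
have n1 : 100 <= n%:R :> R by rewrite ler_nat.
have /andP[ql qu] := sqrt5_bounds R; have [ml mu] := peak_bounds R n100.
have /andP[tl tu] := peak_itv R n; rewrite -/m in ml mu tl tu.
have q5 := sqrt5_sqr R.
have n5l : 5 * m%:R ^+ 2 <= n%:R ^+ 2 :> R by rewrite -q5; nra.
have n5u : n%:R ^+ 2 <= 5 * (m%:R + 1) ^+ 2 :> R by rewrite -q5; nra.
pose f (j : nat) : R := ln (A R n j) + (j%:R - m%:R) ^+ 2 / (4 * n%:R).
have fE (j : nat) : f j.+1 - f j = ln (A R n j.+1) - ln (A R n j) +
    (2 * (j%:R - m%:R) + 1) / (4 * n%:R).
  by rewrite /f -natr1; field; apply: lt0r_neq0; lra.
have right (j : nat) : (m <= j < n)%N -> f j.+1 - f j <= 13 / n%:R.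
  move=> /andP[mj jn]; have mjR : m%:R <= j%:R :> R by rewrite ler_nat.
  have jnR : j%:R <= n%:R :> R by rewrite ler_nat ltnW.
  have j0 : (0 < j < n)%N by rewrite jn andbT -(ltr_nat R); lra.
  rewrite fE; have := A_increment_le R j0; set r := ln _ - _.
  set y := j%:R - m%:R.
  have y0 : 0 <= y by rewrite subr_ge0.
  suff h : (n%:R ^+ 2 - 5 * j%:R ^+ 2 - 2 * j%:R) / (4 * j%:R ^+ 2 + 2 * j%:R) <=
      (12 - 5 / 6 * y) / n%:R :> R.
    move=> /le_trans/(_ h) {}h.
    have -> : (13 : R) / n%:R = (12 - 5 / 6 * y) / n%:R + (1 + 5 / 6 * y) / n%:R.
      by field; apply: lt0r_neq0; lra.
    apply: lerD => //; rewrite invfM mulrA ler_pM2r ?invr_gt0; lra.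
  have mE : m%:R = j%:R - y :> R by rewrite /y; ring.
  clear r; clearbody y; move: n5u; rewrite mE in ml *.
  rewrite ler_pdivrMr; last by nra.
  rewrite mulrAC ler_pdivlMr; last lra.
  move: (n%:R : R) (j%:R : R) n1 ml jnR {mE mjR mu tl tu n5l fE} => N J n1 ml jnR n5u.
  have : N ^+ 2 - 5 * J ^+ 2 - 2 * J <= - 5 * (y * J) + 8 * J + 5 by nra.
  have h1 : N * (8 * J + 5) <= 12 * (4 * J ^+ 2 + 2 * J) by nra.
  have yJ : 0 <= y * J by nra.
  have h2 : y * J * (10 / 3 * J + 5 / 3) <= y * J * (5 * N) by nra.
  nra.
have left (j : nat) : (k <= j < m)%N -> - f j.+1 - - f j <= 13 / n%:R.
  move=> /andP[kj jm]; have jmR : j%:R <= m%:R :> R by rewrite ler_nat ltnW.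
  have j0R : 0 <= j%:R :> R by [].
  have jn : (0 < j < n)%N.
    rewrite (leq_trans k0 kj)/= -(ltr_nat R); apply: le_lt_trans jmR _; lra.
  rewrite -opprD fE; have := A_increment_ge R jn; set r := ln _ - _.
  pose y : R := m%:R - j%:R.
  have y0 : 0 <= y by rewrite subr_ge0.
  suff h : (y / 2 - 2) / n%:R <=
    (n%:R ^+ 2 - 5 * j%:R ^+ 2 - 2 * j%:R) / (n%:R ^+ 2 - j%:R ^+ 2) :> R.
    move=> /(le_trans h) {}h; rewrite lerNl.
    have -> : - (13 / n%:R) = (y / 2 - 2) / n%:R + - (11 + y / 2) / n%:R :> R.
      by field; apply: lt0r_neq0; lra.
    apply: lerD => //; rewrite invfM mulrA ler_pM2r ?invr_gt0; last lra.
    by rewrite /y; lra.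
  have mE : m%:R = j%:R + y :> R by rewrite /y; ring.
  clear r; clearbody y; move: n5l; rewrite mE in ml mu *.
  move: (n%:R : R) (j%:R : R) n1 ml mu j0R {mE tl tu jmR n5u fE right}.
  move=> N J n1 ml mu j0R n5l.
  rewrite ler_pdivlMr; last by nra.
  rewrite mulrAC ler_pdivrMr; last lra.
  have h1 : 5 * (y * (J + y)) - 2 * J <= N ^+ 2 - 5 * J ^+ 2 - 2 * J by nra.
  have h2 : 2 * (J * N) <= 2 * (N ^+ 2 - J ^+ 2) by nra.
  have h3 : y * (N / 3) <= y * (J + y) by nra.
  have h4 : y * (N / 3) * N <= y * (J + y) * N by nra.
  have h5 : 0 <= y * J ^+ 2 by rewrite mulr_ge0 ?sqr_ge0.
  have h6 : 0 <= y * N ^+ 2 by rewrite mulr_ge0 ?sqr_ge0.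
  nra.
have ub : 13 / n%:R * (k%:R - m%:R) <= 13 :> R.
  have : k%:R <= n%:R :> R by rewrite ler_nat.
  rewrite mulrAC ler_pdivrMr; last lra.
  by move=> ?; rewrite ler_pM2l; lra.
have ub' : 13 / n%:R * (m%:R - k%:R) <= 13 :> R.
  have : 0 <= k%:R :> R by [].
  rewrite mulrAC ler_pdivrMr; last lra.
  by move=> ?; rewrite ler_pM2l; lra.
have fm : f m = ln (A R n m) by rewrite /f subrr expr0n /= mul0r addr0.
suff : f k - f m <= 13 by rewrite fm /f; lra.
have [mk|km] := leqP m k.
  apply: le_trans ub; apply: telescope_le => // j /andP[mj jk].
  by apply: right; rewrite mj (leq_trans jk).
apply: le_trans ub'; rewrite -[f k]opprK addrC.
exact: (@telescope_le _ (fun j => - f j) _ _ _ (ltnW km)).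
Qed.

(** * Lattice sums as integrals *)

Definition cell (R : realType) (c s : R) (k : nat) : set R :=
  [set` Interval (BLeft ((k%:R - c) / s)) (BLeft ((k.+1%:R - c) / s))].

(** truncn sends all negative numbers to 0, which is why f must vanish at 0: the
    step function is then 0 on the whole negative side. *)
Lemma step_function_cells (R : realType) (c s : R) (n : nat) (f : nat -> R) :
  0 < s -> f 0 = 0 -> (forall k, (n < k)%N -> f k = 0) ->
  (fun t => f (Num.truncn (c + s * t))) =
  (fun t => \sum_(k < n.+1) f k * \1_(cell c s k) t).
Proof.
move=> s0 f0 fn; apply/funext => t.
have cellE (k : nat) : \1_(cell c s k) t = (k%:R <= c + s * t < k.+1%:R)%R%:R :> R.
  rewrite indicE; congr (nat_of_bool _)%:R; apply/idP/idP; rewrite inE /cell /= in_itv /=.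
    by rewrite ler_pdivrMr// ltr_pdivlMr// lerBlDl ltrBrDl mulrC.
  by rewrite ler_pdivrMr// ltr_pdivlMr// lerBlDl ltrBrDl mulrC.
under eq_bigr do rewrite cellE.
have [u0|u0] := ltP (c + s * t) 0.
  rewrite (@truncn0Pn _ _ _) ?f0; last by rewrite -ltNge (lt_trans u0).
  rewrite big1// => k _; have -> : (k%:R <= c + s * t) = false.
    by apply/negbTE; rewrite -ltNge (lt_le_trans u0).
  by rewrite mulr0.
have tE (k : nat) : (k%:R <= c + s * t < k.+1%:R) = (Num.truncn (c + s * t) == k).
  by rewrite truncn_eq.
under eq_bigr do rewrite tE.
set p := Num.truncn _; have [pn|np] := ltnP p n.+1.
  rewrite (bigD1 (Ordinal pn)) //= eqxx mulr1 big1 ?addr0// => k kp.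
  rewrite (_ : (p == k) = false) ?mulr0//; apply: contraNF kp => /eqP pk.
  by apply/eqP/val_inj.
rewrite fn// big1// => k _; rewrite (_ : (p == k) = false) ?mulr0//.
by apply/negbTE; rewrite neq_ltn (leq_trans (ltn_ord k) np) orbT.
Qed.

Lemma measurable_step_function (R : realType) (c s : R) (n : nat) (f : nat -> R) :
  0 < s -> f 0 = 0 -> (forall k, (n < k)%N -> f k = 0) ->
  measurable_fun [set: R] (fun t => f (Num.truncn (c + s * t))).
Proof.
move=> s0 f0 fn; rewrite (step_function_cells c s0 f0 fn).
apply: measurable_sum => k; by apply: measurable_funM => //; apply: measurable_indic; exact: measurable_itv.
Qed.

Lemma integral_step_function (R : realType) (c s : R) (n : nat) (f : nat -> R) :
  0 < s -> f 0 = 0 -> (forall k, (n < k)%N -> f k = 0) ->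
  (\int[lebesgue_measure]_t (f (Num.truncn (c + s * t)))%:E =
   (s^-1 * \sum_(k < n.+1) f k)%:E)%E.
Proof.
move=> s0 f0 fn.
have -> : (fun t => (f (Num.truncn (c + s * t)))%:E) =
    (fun t => \sum_(k < n.+1) (f k)%:E * (\1_(cell c s k) t)%:E)%E.
  apply/funext => t; have /(congr1 (fun h => h t)) /= -> :=
    step_function_cells c s0 f0 fn.
  by rewrite -sumEFin; apply: eq_bigr => k _; rewrite EFinM.
rewrite integral_sum//=; last first.
  by move=> k; apply: integrableZl => //; exact: integrable_indic_itv.
rewrite mulr_sumr -sumEFin; apply: eq_bigr => k _.
rewrite integralZl//; last exact: integrable_indic_itv.
rewrite integral_indic; [|exact: measurableT|exact: measurable_itv].
rewrite setIT /= /cell lebesgue_measure_itv /= lte_fin.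
rewrite ltr_pM2r ?invr_gt0// ltrD2r ltr_nat ltnSn -EFinB -EFinM.
by congr (_%:E); rewrite -natr1; field; rewrite lt0r_neq0.
Qed.

Definition gauss (R : realType) (t : R) : R := expR (- t ^+ 2 / 2).

(** The weight is a multiple of the normal density of variance 1 / (2 a). *)
Lemma integrable_gauss_scaled (R : realType) (a : R) : 0 < a ->
  lebesgue_measure.-integrable [set: R] (fun t => (expR (- (a * t ^+ 2)))%:E).
Proof.
move=> a0; pose s := Num.sqrt (2 * a)^-1.
have a20 : 0 < (2 * a)^-1 by rewrite invr_gt0 mulr_gt0.
have s0 : s != 0 by rewrite gt_eqF// sqrtr_gt0.
have -> : (fun t : R => (expR (- (a * t ^+ 2)))%:E) =
    (fun t => (normal_peak s)^-1%:E * (normal_pdf 0 s t)%:E)%E.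
  apply/funext => t; rewrite normal_pdfE// -EFinM /=; congr (_%:E).
  rewrite [RHS]mulrA mulVf ?gt_eqF ?normal_peak_gt0// mul1r /normal_fun subr0.
  rewrite sqr_sqrtr ?ltW//; congr expR.
  rewrite -mulr_natr; field; exact: lt0r_neq0.
by apply: integrableZl => //; exact: integrable_normal_pdf.
Qed.

(** The rounding error, at most 1 before rescaling, is killed by s n --> +oo. *)
Lemma lattice_point_cvg (R : realType) (c s : nat -> R) (t : R) :
  s @ \oo --> +oo -> (\forall n \near \oo, 0 <= c n + s n * t) ->
  ((Num.truncn (c n + s n * t))%:R - c n) / s n @[n --> \oo] --> t.
Proof.
move=> soo nn; apply/cvgrPdist_le => e e0; near=> n.
have s0 : e^-1 <= s n by near: n; exact: (cvgryPge _).1.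
have sn0 : 0 < s n by apply: lt_le_trans s0; rewrite invr_gt0.
have u0 : 0 <= c n + s n * t by near: n.
have /andP[h1 h2] := truncn_itv u0; rewrite -natr1 in h2.
set k := _%:R in h1 h2 *.
have se : 1 <= e * s n by rewrite -ler_pdivrMl// mulr1.
have -> : t - (k - c n) / s n = (c n + s n * t - k) / s n.
  by field; exact: lt0r_neq0.
rewrite ger0_norm; last by rewrite divr_ge0 ?subr_ge0// ltW.
rewrite ler_pdivrMr//.
by apply: le_trans se; rewrite lerBlDl ltW// addrC.
Unshelve. all: by end_near. Qed.

(** Rows w n whose profile around c n, at scale s n, converges to the Gaussian
    bump, with a Gaussian bound on the tails uniform in n.  The value at 0 has
    to vanish because of the convention of truncn on negative arguments. *)
Record gaussian_array (R : realType) (w : nat -> nat -> R) (c s : nat -> R) : Prop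
  := GaussianArray {
  array_ge0 : forall n k, 0 <= w n k;
  array_0 : forall n, (0 < n)%N -> w n 0 = 0;
  array_support : forall n k, (n < k)%N -> w n k = 0;
  array_scale : s @ \oo --> +oo;
  array_center : forall t, \forall n \near \oo, 0 <= c n + s n * t;
  array_local : forall t,
    w n (Num.truncn (c n + s n * t)) @[n --> \oo] --> gauss t;
  array_tail : exists C a : R, 0 < a /\ \forall n \near \oo, forall k,
    w n k <= C * expR (- (a * ((k%:R - c n) / s n) ^+ 2)) }.

(** The one limit theorem from which mass, mean, variance and distribution
    function all follow.  The summand may fail to converge at one point x0,
    where the limit of an indicator jumps. *)
Lemma gaussian_array_sum_cvg (R : realType) (w : nat -> nat -> R) (c s : nat -> R)
    (h : nat -> nat -> R) (H : R -> R) (D x0 : R) :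
  gaussian_array w c s ->
  measurable_fun [set: R] H ->
  (\forall n \near \oo, forall k, `|h n k| <= D * (1 + ((k%:R - c n) / s n) ^+ 2)) ->
  (forall t, t != x0 ->
     h n (Num.truncn (c n + s n * t)) @[n --> \oo] --> H t) ->
  (s n)^-1 * (\sum_(k < n.+1) h n k * w n k) @[n --> \oo] -->
    \int[lebesgue_measure]_t (H t * gauss t).
Proof.
move=> [w0 w00 wn soo cs wg [C [a [a0 wC]]]] mH hD hH.
pose f n (t : R) : \bar R := (h n (Num.truncn (c n + s n * t)) *
  w n (Num.truncn (c n + s n * t)))%:E.
(* 1 + z^2 <= (1 + 2/a) exp (a z^2 / 2), and z is within 1 of t, so that
     z^2 >= t^2 / 2 - 1: half of the Gaussian decay absorbs the polynomial,
     half of the rest the rounding. *)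
pose G (t : R) : \bar R :=
  ((`|D| * `|C| * (1 + 2 / a) * expR (a / 2))%:E * (expR (- (a / 4 * t ^+ 2)))%:E)%E.
have sN : \forall n \near \oo, 1 <= s n by exact: (cvgryPge _).1.
have [N _ NP] : \forall n \near \oo, [/\ (0 < n)%N, 1 <= s n,
  (forall k, `|h n k| <= D * (1 + ((k%:R - c n) / s n) ^+ 2)) &
  (forall k, w n k <= C * expR (- (a * ((k%:R - c n) / s n) ^+ 2)))].
  by near=> n; split; near: n => //; exact: nbhs_infty_gt.
have fG n t : (N <= n)%N -> (`|f n t| <= G t)%E.
  move=> /NP[n0 s1 hn wCn]; rewrite /f /G -EFinM lee_fin.
  have cst0 : 0 <= `|D| * `|C| * (1 + 2 / a) * expR (a / 2) * expR (- (a / 4 * t ^+ 2)).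
    by rewrite !mulr_ge0 ?expR_ge0// addr_ge0// divr_ge0// ltW.
  have [u0|u0] := ltP (c n + s n * t) 0.
    rewrite (@truncn0Pn _ _ _) ?w00 ?mulr0 ?normr0//.
    by rewrite -ltNge (lt_trans u0).
  have sn0 : 0 < s n by apply: lt_le_trans s1.
  have := truncn_itv u0; rewrite -natr1.
  move: (Num.truncn _) => k /andP[h1 h2].
  have := hn k; have := wCn k; have := w0 n k.
  pose z := (k%:R - c n) / s n; rewrite -/z => wk0 wk hk.
  have zt : t ^+ 2 <= 2 * z ^+ 2 + 2.
    have ztE : s n * (t - z) = c n + s n * t - k%:R.
      by rewrite /z; field; exact: lt0r_neq0.
    have : 0 <= t - z by rewrite -(pmulr_rge0 _ sn0) ztE subr_ge0.
    have : t - z <= 1.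
      rewrite -(ler_pM2l sn0) ztE mulr1; apply: le_trans s1.
      by rewrite lerBlDl addrC ltW// addrC.
    move: (t) z {wk hk ztE} => T z' ? ?.
    have : (T - z') ^+ 2 <= 1 by nra.
    have := sqr_ge0 (T - 2 * z'); nra.
  clearbody z; rewrite normrM (ger0_norm wk0).
  have z0 : 0 <= z ^+ 2 by exact: sqr_ge0.
  have hk' : `|h n k| <= `|D| * ((1 + 2 / a) * expR (a / 2 * z ^+ 2)).
    apply: le_trans hk _; apply: (@le_trans _ _ (`|D| * (1 + z ^+ 2))).
      by rewrite ler_wpM2r ?ler_norm// addr_ge0.
    rewrite ler_wpM2l//; have e1 := expR_ge1Dx (a / 2 * z ^+ 2).
    have az : 0 <= a / 2 * z ^+ 2 by rewrite mulr_ge0// divr_ge0// ltW.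
    have -> : 1 + z ^+ 2 = 1 + 2 / a * (a / 2 * z ^+ 2).
      by field; exact: lt0r_neq0.
    have a2 : 0 <= 2 / a by rewrite divr_ge0// ltW.
    move: (2 / a) (a / 2 * z ^+ 2) (expR _) a2 az e1 => b y E b0 y0 yE.
    nra.
  have wk' : w n k <= `|C| * expR (- (a * z ^+ 2)).
    by apply: le_trans wk _; rewrite ler_wpM2r ?expR_ge0// ler_norm.
  apply: le_trans (ler_pM _ _ hk' wk') _ => //.
  have -> : `|D| * ((1 + 2 / a) * expR (a / 2 * z ^+ 2)) * (`|C| * expR (- (a * z ^+ 2))) =
      `|D| * `|C| * (1 + 2 / a) * (expR (a / 2 * z ^+ 2) * expR (- (a * z ^+ 2))).
    by ring.
  rewrite -[leRHS]mulrA -!expRD ler_wpM2l ?ler_expR//.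
    by rewrite !mulr_ge0// addr_ge0// divr_ge0// ltW.
  have : a * t ^+ 2 <= a * (2 * z ^+ 2 + 2) by rewrite ler_pM2l.
  lra.
have mG : lebesgue_measure.-integrable [set: R] G.
  by apply: integrableZl => //; apply: integrable_gauss_scaled; rewrite divr_gt0.
have hw0 n : (N <= n)%N -> h n 0 * w n 0 = 0.
  by move=> /NP[n0 _ _ _]; rewrite w00 ?mulr0.
have hwn n k : (n < k)%N -> h n k * w n k = 0 by move=> nk; rewrite wn ?mulr0.
have s0 n : (N <= n)%N -> 0 < s n by move=> /NP[_ s1 _ _]; apply: lt_le_trans s1.
have mgauss : measurable_fun [set: R] (@gauss R).
  apply: measurableT_comp => //; apply: measurable_funM => //.
  by apply: measurableT_comp => //; exact: measurable_funX.
have [] := @dominated_convergence _ _ R lebesgue_measure [set: R]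
  measurableT (fun n => f (n + N)%N) (fun t => (H t * gauss t)%:E) G.
- move=> n; apply/measurable_EFinP.
  have Nn := leq_addl n N.
  exact: (measurable_step_function (c _) (s0 _ Nn) (hw0 _ Nn) (hwn _)).
- by apply/measurable_EFinP; apply: measurable_funM.
- exists [set x0]; split => //; first exact: lebesgue_measure_set1.
  apply: subsetCl => t /= tx0 _; apply: cvg_EFin; first exact: nearW.
  have : h n (Num.truncn (c n + s n * t)) * w n (Num.truncn (c n + s n * t))
      @[n --> \oo] --> H t * gauss t.
    by apply: cvgM; [apply: hH; apply/eqP|exact: wg].
  by rewrite -(cvg_shiftn N).
- by [].
- by apply: aeW => t n _; apply: fG; exact: leq_addl.
move=> /(integrable_fin_num measurableT)/fineK Hg _.
rewrite -Hg => /fine_cvg.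
have -> : fine \o (fun n => \int[lebesgue_measure]_x f (n + N)%N x)%E =
  (fun n => (s (n + N)%N)^-1 *
     \sum_(k < (n + N).+1) h (n + N)%N k * w (n + N)%N k).
  apply/funext => n /=; have Nn := leq_addl n N.
  by rewrite /f (integral_step_function (c _) (s0 _ Nn) (hw0 _ Nn) (hwn _)).
by move=> h1; rewrite -(cvg_shiftn N).
Unshelve. all: by end_near. Qed.

(** * Moments of the Gaussian weight *)

Lemma continuous_gauss (R : realType) : continuous (@gauss R).
Proof.
move=> t; apply: (@continuous_comp _ _ _ (fun t : R => - t ^+ 2 / 2) expR).
  by apply: cvgM; [apply: cvgN; exact: exprn_continuous|exact: cvg_cst].
exact: continuous_expR.
Qed.

Lemma is_derive_gauss (R : realType) (t : R) : is_derive t 1 (@gauss R) (- t * gauss t).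
Proof.
rewrite /gauss; apply: is_derive_eq.
by rewrite /GRing.scale /=; field.
Qed.

Lemma gauss_moment_le (R : realType) (t : R) :
  (1 + t ^+ 2) * gauss t <= 5 * expR (- (4^-1 * t ^+ 2)).
Proof.
(* One half of the exponential absorbs the factor 1 + t^2. *)
have -> : gauss t = expR (- (4^-1 * t ^+ 2)) * expR (- (4^-1 * t ^+ 2)).
  by rewrite -expRD; congr expR; field.
rewrite mulrA ler_pM2r ?expR_gt0// expRN ler_pdivrMr ?expR_gt0//.
have := expR_ge1Dx (4^-1 * t ^+ 2); have := sqr_ge0 t; lra.
Qed.

Lemma normr_moment_le5 (R : realType) (h t : R) : `|h| <= 1 + t ^+ 2 ->
  `|h * gauss t| <= 5.
Proof.
move=> hB; rewrite normrM (ger0_norm (expR_ge0 _)).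
apply: (@le_trans _ _ ((1 + t ^+ 2) * gauss t)); first by rewrite ler_pM2r ?expR_gt0.
apply: le_trans (gauss_moment_le t) _.
rewrite ler_piMr// expR_le1; have := sqr_ge0 t; lra.
Qed.

Lemma normr_le1D_sqr (R : realType) (t : R) : `|t| <= 1 + t ^+ 2.
Proof.
by have := sqr_ge0 (t - 1); have := sqr_ge0 (t + 1); rewrite ler_norml; nra.
Qed.

Lemma integrable_moment (R : realType) (H : R -> R) :
  measurable_fun [set: R] H -> (forall t, `|H t| <= 1 + t ^+ 2) ->
  lebesgue_measure.-integrable [set: R] (fun t => (H t * gauss t)%:E).
Proof.
move=> mH HB.
have mgauss : measurable_fun [set: R] (@gauss R).
  by apply: continuous_measurable_fun; exact: continuous_gauss.
apply: (@le_integrable _ _ R lebesgue_measure [set: R] measurableT _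
  (fun t => 5%:E * (expR (- (4^-1 * t ^+ 2)))%:E)%E).
- by apply/measurable_EFinP; apply: measurable_funM.
- move=> t _; rewrite -EFinM /= lee_fin normrM.
  rewrite (ger0_norm (expR_ge0 _)) [leRHS]ger0_norm ?mulr_ge0 ?expR_ge0//.
  by apply: le_trans (gauss_moment_le t); rewrite ler_pM2r ?expR_gt0.
- by apply: integrableZl => //; apply: integrable_gauss_scaled.
Qed.

(** The integral over [-n, n] is F n - F (-n). *)
Lemma integral_derivative_vanishing (R : realType) (F f : R -> R) :
  (forall t : R, is_derive t 1 F (f t)) -> continuous f ->
  lebesgue_measure.-integrable [set: R] (EFin \o f) ->
  F n%:R @[n --> \oo] --> 0 -> F (- n%:R) @[n --> \oo] --> 0 ->
  \int[lebesgue_measure]_t f t = 0.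
Proof.
move=> dF cf fi F1 F2.
(* Indices n.+1 keep the intervals nondegenerate. *)
pose I n : set R := `[- n.+1%:R, n.+1%:R]%classic.
have mf : measurable_fun [set: R] f by exact: continuous_measurable_fun.
have [] := @dominated_convergence _ _ R lebesgue_measure [set: R] measurableT
  (fun n => (EFin \o f) \_ (I n)) (EFin \o f) (fun t => `|(f t)%:E|)%E.
- move=> n; apply/(measurable_restrictT _ (measurable_itv _)).
  by apply: measurable_funTS; exact/measurable_EFinP.
- exact/measurable_EFinP.
- apply: aeW => t _; apply: cvg_near_cst; near=> n.
  rewrite patchE mem_set// /I /= in_itv /= -ler_norml -natr1.
  rewrite (@le_trans _ _ n%:R) ?lerDl//.
  by near: n; exact: nbhs_infty_ger.
- exact: integrable_abse.
- by apply: aeW => t n _; rewrite patchE; case: ifP => //; rewrite abse0.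
move=> _ _.
rewrite -[X in _ --> X](fineK (integrable_fin_num measurableT fi)) => /fine_cvg.
have -> : fine \o (fun n => \int[lebesgue_measure]_t ((EFin \o f) \_ (I n)) t)%E =
   (fun n => F n.+1%:R - F (- n.+1%:R)).
  apply/funext => n /=; rewrite -integral_mkcond /=.
  have lt0 : - n.+1%:R < n.+1%:R :> R by rewrite gtrN ?ltr0n.
  rewrite (@continuous_FTC2 _ f F)//.
  - exact: continuous_subspaceT.
  - have cF : continuous F.
      by move=> t; apply/differentiable_continuous/derivable1_diffP; case: (dF t).
    split => [t _||]; first by case: (dF t).
    + exact/cvg_at_right_filter/cF.
    + exact/cvg_at_left_filter/cF.
  - by move=> t _; rewrite derive1E derive_val.
move=> h; rewrite -(cvg_shiftS (fun n => F n%:R)) in F1.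
rewrite -(cvg_shiftS (fun n => F (- n%:R))) in F2.
have h0 : F n.+1%:R - F (- n.+1%:R) @[n --> \oo] --> (0 : R).
  by rewrite -[X in _ --> X](subr0 (0 : R)); apply: cvgB.
exact: (cvg_unique _ h h0).
Unshelve. all: by end_near. Qed.

(** If t F(t) is bounded then F vanishes at infinity. *)
Lemma cvg_harmonic_bound (R : realType) (F : R -> R) (K : R) :
  (forall t, `|t * F t| <= K) -> F n%:R @[n --> \oo] --> 0 /\
  F (- n%:R) @[n --> \oo] --> 0.
Proof.
move=> FK; have K0 : 0 <= K by apply: le_trans (FK 0).
have main (u : nat -> R) : (forall n, `|u n| = n%:R) -> F (u n) @[n --> \oo] --> 0.
  move=> un; apply/cvgr0Pnorm_le => e e0; near=> n.
  have n0 : 0 < n%:R :> R by rewrite ltr0n; near: n; exact: nbhs_infty_gt.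
  rewrite -(ler_pM2l n0) -(un n) -normrM un; apply: le_trans (FK _) _.
  rewrite -ler_pdivrMr//; near: n; exact: nbhs_infty_ger.
by split; apply: main => n; rewrite ?normrN normr_nat.
Unshelve. all: by end_near. Qed.

(** t exp (- t^2 / 2) is the derivative of - exp (- t^2 / 2). *)
Lemma integral_gauss1 (R : realType) : \int[lebesgue_measure]_t (t * gauss t) = 0 :> R.
Proof.
have i1 : lebesgue_measure.-integrable [set: R] (fun t : R => (t * gauss t)%:E).
  by apply: integrable_moment => // t; exact: normr_le1D_sqr.
have [|F1 F2] := @cvg_harmonic_bound R (fun t => - gauss t) 5.
  by move=> t; rewrite mulrN normrN; apply: normr_moment_le5; exact: normr_le1D_sqr.
apply: (integral_derivative_vanishing (F := fun t : R => - gauss t)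
  (f := fun t : R => t * gauss t) _ _ i1 F1 F2).
  move=> t; have dg := is_derive_gauss t; apply: is_derive_eq; ring.
move=> t; apply: cvgM; [exact: cvg_id|exact: continuous_gauss].
Qed.

(** (1 - t^2) exp (- t^2 / 2) is the derivative of t exp (- t^2 / 2). *)
Lemma integral_gauss2 (R : realType) :
  \int[lebesgue_measure]_t (t ^+ 2 * gauss t) = \int[lebesgue_measure]_t gauss t :> R.
Proof.
have i0 : lebesgue_measure.-integrable [set: R] (fun t : R => (1 * gauss t)%:E).
  by apply: integrable_moment => // t; rewrite normr1 lerDl sqr_ge0.
have i2 : lebesgue_measure.-integrable [set: R] (fun t : R => (t ^+ 2 * gauss t)%:E).
  apply: integrable_moment => // t.
  by rewrite ger0_norm ?sqr_ge0// lerDr.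
have i02 : lebesgue_measure.-integrable [set: R] (fun t : R => (1 * gauss t - t ^+ 2 * gauss t)%:E).
  by under eq_fun do rewrite EFinB; exact: integrableB.
have [|F1 F2] := @cvg_harmonic_bound R (fun t => t * gauss t) 5.
  move=> t; rewrite mulrA; apply: normr_moment_le5.
  by rewrite ger0_norm -?expr2 ?sqr_ge0// lerDr.
have := integral_derivative_vanishing (F := fun t : R => t * gauss t)
  (f := fun t : R => 1 * gauss t - t ^+ 2 * gauss t) _ _ i02 F1 F2.
rewrite RintegralB// => h; apply/esym/eqP; rewrite -subr_eq0; apply/eqP.
under [X in X - _]eq_Rintegral do rewrite -[gauss _]mul1r.
apply: h => t.
  have dg := is_derive_gauss t; apply: is_derive_eq.
  rewrite /GRing.scale /=; ring.
by apply: cvgB; apply: cvgM; do ?[exact: cvg_cst|exact: continuous_gauss|exact: exprn_continuous].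
Qed.

Lemma integral_gauss0 (R : realType) :
  \int[lebesgue_measure]_t gauss t = Num.sqrt (2 * pi) :> R.
Proof.
have peak1 : Num.sqrt (2 * pi) = (normal_peak (1 : R))^-1.
  by rewrite /normal_peak invrK expr1n mul1r mulr_natl.
have gaussE (t : R) : gauss t = Num.sqrt (2 * pi) * normal_pdf 0 1 t.
  rewrite peak1 normal_pdfE ?oner_eq0// mulrA mulVf ?mul1r.
    by rewrite /normal_fun subr0 expr1n.
  by rewrite gt_eqF// normal_peak_gt0 ?oner_eq0.
under eq_Rintegral do rewrite gaussE.
rewrite RintegralZl//; last exact: integrable_normal_pdf.
by rewrite /Rintegral integral_normal_pdf mulr1.
Qed.

Lemma integral_gauss_Phi (R : realType) (x : R) :
  \int[lebesgue_measure]_t ((t <= x)%R%:R * gauss t) = Num.sqrt (2 * pi) * Phi x.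
Proof.
rewrite /Phi mulrA divff ?mul1r; last first.
  by rewrite gt_eqF// sqrtr_gt0 mulr_gt0// pi_gt0.
rewrite [RHS]Rintegral_mkcond; apply: eq_Rintegral => t _.
rewrite patchE /gauss; have [tx|xt] := leP t x.
  by rewrite mem_set ?mul1r//= in_itv.
by rewrite memNset ?mul0r//= in_itv /= leNgt xt.
Qed.

(** * The coefficients near and far from the peak *)

(** The asymptotic standard deviation, chosen so that the quadratic term
    (5 sqrt 5 / 4) x^2 / n of [ln_A_local] is z^2 / 2 for z = x / width. *)
Definition width (R : realType) (n : nat) : R :=
  Num.sqrt (2 * n%:R / (5 * sqrt5 R)).

(** Normalizing by the value at the peak, rather than by the row sum, gives the
    profile the limit exp (- t^2 / 2) before the row sum is known. *)
Definition weight (R : realType) (n k : nat) : R := A R n k / A R n (peak R n).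

Lemma width_sqr (R : realType) (n : nat) :
  width R n ^+ 2 = 2 * n%:R / (5 * sqrt5 R).
Proof. by rewrite sqr_sqrtr// divr_ge0 ?mulr_ge0// sqrtr_ge0. Qed.

Lemma width_sqr_bounds (R : realType) (n : nat) :
  n%:R / 6 <= width R n ^+ 2 <= n%:R / 5.
Proof.
have /andP[ql qu] := sqrt5_bounds R; rewrite width_sqr.
have n0 : 0 <= n%:R :> R by [].
have q0 : 0 < 5 * sqrt5 R by lra.
by rewrite ler_pdivlMr// ler_pdivrMr//; apply/andP; split; nra.
Qed.

Lemma width_cvgy (R : realType) : width R n @[n --> \oo] --> +oo.
Proof.
apply/cvgryPge => M; near=> n.
have nM : 6 * M ^+ 2 <= n%:R by near: n; exact: nbhs_infty_ger.
have /andP[h _] := width_sqr_bounds R n.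
have s0 : 0 <= width R n by exact: sqrtr_ge0.
have [M0|/ltW M0] := leP 0 M; last exact: le_trans s0.
by rewrite -(ler_sqr M0 s0); lra.
Unshelve. all: by end_near. Qed.

Lemma peak_range (R : realType) (n : nat) : (100 <= n)%N -> (0 < peak R n <= n)%N.
Proof.
move=> n100; have n1 : 100 <= n%:R :> R by rewrite ler_nat.
have [ml mu] := peak_bounds R n100.
by rewrite -(ltr_nat R) -(ler_nat R); apply/andP; split; lra.
Qed.

Lemma weight_expR (R : realType) (n k : nat) : (100 <= n)%N -> (0 < k <= n)%N ->
  weight R n k = expR (ln (A R n k) - ln (A R n (peak R n))).
Proof.
move=> n100 kn; have a0 := A_gt0 R kn; have b0 := A_gt0 R (peak_range R n100).
by rewrite -ln_div ?posrE// lnK// posrE divr_gt0.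
Qed.

Lemma weight_tail (R : realType) (n k : nat) : (100 <= n)%N ->
  weight R n k <= expR 13 *
    expR (- ((10 * sqrt5 R)^-1 * ((k%:R - (peak R n)%:R) / width R n) ^+ 2)).
Proof.
move=> n100; have n0 : (0 < n)%N by lia.
have [kn|] := boolP (0 < k <= n)%N; last first.
  rewrite negb_and -eqn0Ngt -ltnNge => k0n; suff -> : weight R n k = 0.
    by rewrite mulr_ge0 ?expR_ge0.
  case/orP: k0n => [/eqP->|nk]; rewrite /weight.
    by rewrite A0 gtn_eqF// mul0r.
  by rewrite A_gt_eq0// mul0r.
rewrite weight_expR// -expRD ler_expR.
have := ln_A_le R n100 kn; congr (_ <= _); congr (_ - _).
have /andP[ql _] := sqrt5_bounds R; have n1 : 100 <= n%:R :> R by rewrite ler_nat.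
rewrite expr_div_n width_sqr; move: (sqrt5 R) (n%:R : R) ql n1 => q N ql n1.
by field; apply/andP; split; apply: lt0r_neq0; lra.
Qed.

Lemma peak_width_ge0 (R : realType) (t : R) :
  \forall n \near \oo, 0 <= (peak R n)%:R + width R n * t.
Proof.
near=> n.
have n100 : (100 <= n)%N by near: n; exact: nbhs_infty_ge.
have nt : 2 * t ^+ 2 <= n%:R by near: n; exact: nbhs_infty_ger.
have n1 : 100 <= n%:R :> R by rewrite ler_nat.
have [ml _] := peak_bounds R n100; have /andP[_ su] := width_sqr_bounds R n.
have : `|width R n * t| <= n%:R / 3.
  rewrite -ler_sqr ?nnegrE//.
  rewrite real_normK ?num_real// exprMn.
  have t2 := sqr_ge0 t; apply: (@le_trans _ _ (n%:R / 5 * t ^+ 2)).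
    by rewrite ler_wpM2r.
  nra.
rewrite ler_norml => /andP[h _]; lra.
Unshelve. all: by end_near. Qed.

(** On a window |z| <= B around the peak the error is O(1 / width). *)
Lemma ln_weight_window (R : realType) (n k : nat) (B : R) :
  let z := (k%:R - (peak R n)%:R) / width R n in
  (100 <= n)%N -> 13 * B ^+ 2 <= n%:R -> `|z| <= B ->
  (0 < k <= n)%N /\
  `|ln (A R n k) - ln (A R n (peak R n)) + z ^+ 2 / 2| <=
    8003 * (1 + B ^+ 2) * B / width R n.
Proof.
move=> z n100 nB zB; have n1 : 100 <= n%:R :> R by rewrite ler_nat.
have [ml mu] := peak_bounds R n100.
have /andP[sl su] := width_sqr_bounds R n.
have s0 : 0 < width R n.
  by rewrite lt0r sqrtr_ge0 andbT -sqrf_eq0 gt_eqF//; lra.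
have B0 : 0 <= B by apply: le_trans zB.
pose x : R := k%:R - (peak R n)%:R.
have zE : z = x / width R n by [].
have xE : x = z * width R n by rewrite zE divfK// gt_eqF.
have xB : `|x| <= B * width R n by rewrite xE normrM (gtr0_norm s0) ler_pM2r.
have x2 : x ^+ 2 <= B ^+ 2 * (n%:R / 5).
  rewrite -real_normK ?num_real//.
  apply: (@le_trans _ _ ((B * width R n) ^+ 2)).
    by rewrite ler_sqr ?nnegrE// mulr_ge0// ltW.
  by rewrite exprMn ler_wpM2l ?sqr_ge0.
have B2 := sqr_ge0 B.
have x8 : `|x| <= n%:R / 8.
  rewrite -ler_sqr ?nnegrE//.
  by rewrite real_normK ?num_real//; nra.
split.
  move: x8; rewrite ler_norml /x => /andP[xl xu].
  by rewrite -(ltr_nat R) -(ler_nat R); apply/andP; split; lra.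
have -> : z ^+ 2 / 2 = 5 * sqrt5 R / 4 * x ^+ 2 / n%:R.
  rewrite zE expr_div_n width_sqr.
  have /andP[ql _] := sqrt5_bounds R.
  by field; apply/andP; split; apply: lt0r_neq0; lra.
have := ln_A_local n100 x8; rewrite -/x.
have : 0 <= 8003 :> R by exact: ler0n.
move: (8003 : R) => C C0 h; apply: le_trans h _.
have n0 : 0 < n%:R :> R by lra.
apply: (@le_trans _ _ (C * (1 + B ^+ 2) / n%:R * (B * width R n))).
  apply: ler_pM => //.
    by rewrite !mulr_ge0 ?invr_ge0 ?sqr_ge0// addr_ge0// sqr_ge0.
  have -> : C * (1 + B ^+ 2) / n%:R = C * (n%:R * (1 + B ^+ 2)) / n%:R ^+ 2.
    by field; exact: lt0r_neq0.
  rewrite ler_pM2r ?invr_gt0 ?exprn_gt0//; apply: ler_wpM2l => //; nra.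
have -> : C * (1 + B ^+ 2) / n%:R * (B * width R n) =
    C * (1 + B ^+ 2) * B * (width R n / n%:R).
  by field; exact: lt0r_neq0.
apply: ler_wpM2l; first by rewrite !mulr_ge0// addr_ge0.
by rewrite ler_pdivrMr// ler_pdivlMl// -expr2; lra.
Qed.

Lemma weight_local (R : realType) (t : R) :
  weight R n (Num.truncn ((peak R n)%:R + width R n * t)) @[n --> \oo] --> gauss t.
Proof.
set k := fun n => Num.truncn ((peak R n)%:R + width R n * t).
pose z n : R := ((k n)%:R - (peak R n)%:R) / width R n.
have zt : z n @[n --> \oo] --> t.
  apply: (@lattice_point_cvg R (fun n => (peak R n)%:R) (width R)).
    exact: width_cvgy.
  exact: peak_width_ge0.
pose D n := ln (A R n (k n)) - ln (A R n (peak R n)) + z n ^+ 2 / 2.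
pose B := `|t| + 1.
pose K := 8003 * (1 + B ^+ 2) * B.
have K0 : 0 <= K.
  by apply: mulr_ge0; [apply: mulr_ge0; [exact: ler0n|]|]; rewrite addr_ge0// sqr_ge0.
have window : \forall n \near \oo,
    (100 <= n)%N /\ (0 < k n <= n)%N /\ `|D n| <= K / width R n.
  near=> n; split; first by near: n; exact: nbhs_infty_ge.
  apply: ln_weight_window.
  - by near: n; exact: nbhs_infty_ge.
  - by near: n; exact: nbhs_infty_ger.
  - rewrite -/(z n) -[z n](subKr t); apply: le_trans (ler_normB _ _) _.
    by rewrite lerD2l; near: n; move/cvgrPdist_le: zt; apply.
have D0 : D n @[n --> \oo] --> 0.
  apply/cvgr0Pnorm_le => e e0; near=> n.
  have [_ [_ DK]] : (100 <= n)%N /\ (0 < k n <= n)%N /\ `|D n| <= K / width R n.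
    by near: n; exact: window.
  have se : K / e + 1 <= width R n by near: n; move/cvgryPge: (@width_cvgy R); apply.
  have s0 : 0 < width R n by apply: lt_le_trans se; rewrite ltr_wpDl// divr_ge0// ltW.
  apply: le_trans DK _; rewrite ler_pdivrMr// -ler_pdivrMl// mulrC.
  by apply: le_trans se; rewrite lerDl.
have : expR (D n - z n ^+ 2 / 2) @[n --> \oo] --> gauss t.
  rewrite /gauss -[X in expR X]add0r mulNr.
  apply: continuous_cvg; first exact: continuous_expR.
  apply: cvgB => //; apply: cvgM; last exact: cvg_cst.
  rewrite expr2; under eq_fun do rewrite expr2.
  exact: cvgM.
apply: cvg_trans; apply: near_eq_cvg; near=> n.
have [n100 [kn _]] : (100 <= n)%N /\ (0 < k n <= n)%N /\ `|D n| <= K / width R n.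
  by near: n; exact: window.
by rewrite weight_expR// /D addrK.
Unshelve. all: by end_near. Qed.

Lemma gaussian_array_weight (R : realType) :
  gaussian_array (weight R) (fun n => (peak R n)%:R) (width R).
Proof.
split.
- by move=> n k; rewrite divr_ge0 ?A_ge0.
- by move=> n n0; rewrite /weight A0 gtn_eqF// mul0r.
- by move=> n k nk; rewrite /weight A_gt_eq0// mul0r.
- exact: width_cvgy.
- exact: peak_width_ge0.
- exact: weight_local.
- exists (expR 13), (10 * sqrt5 R)^-1; split.
    by have /andP[ql _] := sqrt5_bounds R; rewrite invr_gt0; lra.
  by near=> n => k; apply: weight_tail; near: n; exact: nbhs_infty_ge.
Unshelve. all: by end_near. Qed.

(** * Pointwise to uniform convergence *)

Lemma Phi_ge0 (R : realType) (x : R) : 0 <= Phi x.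
Proof. by rewrite -lee_fin PhiE. Qed.

Lemma Phi_le1 (R : realType) (x : R) : Phi x <= 1.
Proof. by rewrite -lee_fin PhiE; exact: probability_le1. Qed.

Lemma Phi_nondecreasing (R : realType) : {homo @Phi R : x y / x <= y}.
Proof.
move=> x y xy; rewrite -lee_fin !PhiE.
by apply: le_measure; rewrite ?inE//; exact: subitvPr.
Qed.

(** The normal density is bounded by its peak value. *)
Lemma Phi_increment_le (R : realType) (x y : R) : x <= y ->
  Phi y - Phi x <= normal_peak (1 : R) * (y - x).
Proof.
move=> xy; rewrite -lee_fin EFinB !PhiE leeBlDl; last by rewrite -PhiE.
have -> : `]-oo, y]%classic = `]-oo, x]%classic `|` `]x, y]%classic :> set R.
  by rewrite -itv_bndbnd_setU// bnd_simp.
apply: (@le_trans _ _ (normal_prob (0:R) 1 `]-oo, x] + normal_prob (0:R) 1 `]x, y])%E).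
  exact: measureU2.
apply: leeD2l => //.
apply: (@le_trans _ _ (\int[lebesgue_measure]_(t in `]x, y]) (normal_peak (1:R))%:E)%E).
  apply: ge0_le_integral => //=.
  - by move=> t _; rewrite lee_fin normal_pdf_ge0.
  - by apply/measurable_EFinP; apply: measurable_funTS; exact: measurable_normal_pdf.
  - by move=> t _; rewrite lee_fin normal_pdf_ub ?oner_neq0.
rewrite integral_cst//= lebesgue_measure_itv /= lte_fin.
case: ifP => _; first by rewrite -EFinB -EFinM.
by rewrite mule0 lee_fin mulr_ge0 ?normal_peak_ge0 ?subr_ge0.
Qed.

Lemma continuous_Phi (R : realType) : continuous (@Phi R).
Proof.
have lip (x y : R) : `|Phi x - Phi y| <= normal_peak (1 : R) * `|x - y|.
  wlog xy : x y / x <= y.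
    move=> h; have [/h//|/ltW/h] := leP x y.
    by rewrite distrC [`|y - x|]distrC.
  rewrite [leLHS]distrC [`|x - y|]distrC !ger0_norm ?subr_ge0//; first exact: Phi_increment_le.
  exact: Phi_nondecreasing.
have p0 : 0 < normal_peak (1 : R) by rewrite normal_peak_gt0// oner_neq0.
move=> x; apply/cvgrPdist_le => e e0; near=> y.
apply: le_trans (lip _ _) _; rewrite -ler_pdivlMl//.
near: y; apply: (@cvgr_dist_le _ _ _ (nbhs x) _ (fun y : R => y) x).
  exact: cvg_id.
by rewrite mulr_gt0// invr_gt0.
Unshelve. all: by end_near. Qed.

Lemma Phi_cdf (R : realType) : exists X : {RV (normal_prob (0:R) 1) >-> R},
  forall x, cdf X x = (Phi x)%:E.
Proof.
have mid : (@idfun R : measurableTypeR R -> R) \in mfun.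
  by rewrite inE; exact: measurable_id.
by exists (mfun_Sub mid) => x; rewrite PhiE.
Qed.

Lemma Phi_cvgy (R : realType) : @Phi R x @[x --> +oo] --> (1 : R).
Proof.
have [X XE] := Phi_cdf R; have := cvg_cdfy1 X.
by rewrite (_ : cdf X = EFin \o @Phi R); [move/fine_cvg|exact/funext].
Qed.

Lemma Phi_cvgNy (R : realType) : @Phi R x @[x --> -oo] --> (0 : R).
Proof.
have [X XE] := Phi_cdf R; have := cvg_cdfNy0 X.
by rewrite (_ : cdf X = EFin \o @Phi R); [move/fine_cvg|exact/funext].
Qed.

Lemma quantile_exists (R : realType) (G : R -> R) (v : R) :
  continuous G -> G x @[x --> -oo] --> (0 : R) -> G x @[x --> +oo] --> (1 : R) ->
  0 < v < 1 -> exists x, G x = v.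
Proof.
move=> cG G0 G1 /andP[v0 v1].
have [a Ga] : exists a, a <= 0 /\ G a <= v.
  near (ninfty_nbhs R) => a; exists a; split; near: a; first exact: nbhs_ninfty_le.
  exact: cvgr_le G0 _ v0.
have [b Gb] : exists b, 0 <= b /\ v <= G b.
  near (pinfty_nbhs R) => b; exists b; split; near: b; first exact: nbhs_pinfty_ge.
  exact: cvgr_ge G1 _ v1.
have [] := @IVT R G a b v.
- by apply: le_trans Ga.1 Gb.1.
- exact: continuous_subspaceT.
- by rewrite ge_min Ga.2/= le_max Gb.2 orbT.
- by move=> c _ cv; exists c.
Unshelve. all: by end_near. Qed.

(** Cut the range of G at the levels i/N.  Between two consecutive quantiles
    monotonicity confines F n and G to almost the same band of height O(1/N),
    so closeness at finitely many points is enough. *)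
Lemma polya (R : realType) (F : nat -> R -> R) (G : R -> R) :
  (forall n, {homo F n : x y / x <= y}) -> (forall n x, 0 <= F n x <= 1) ->
  {homo G : x y / x <= y} -> (forall x, 0 <= G x <= 1) -> continuous G ->
  G x @[x --> -oo] --> (0 : R) -> G x @[x --> +oo] --> (1 : R) ->
  (forall x, F n x @[n --> \oo] --> G x) ->
  ereal_sup [set (`|F n x - G x|)%:E | x in [set: R]] @[n --> \oo] --> 0%E.
Proof.
move=> Fmono F01 Gmono G01 cG G0 G1 FG.
have unif e : 0 < e -> \forall n \near \oo, forall x, `|F n x - G x| <= e.
  move=> e0; pose N := (Num.truncn (3 / e)).+1.
  have N0 : 0 < N%:R :> R by rewrite ltr0n.
  have Ne : 3 / N%:R <= e.
    rewrite ler_pdivrMr// mulrC -ler_pdivrMr//; apply/ltW; exact: truncnS_gt.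
  have /choice[q qE] : forall i : nat, exists x, (0 < i < N)%N -> G x = i%:R / N%:R.
    move=> i; have [/andP[i0 iN]|] := boolP (0 < i < N)%N; last by exists 0.
    have [x xE] : exists x, G x = i%:R / N%:R; last by exists x.
    apply: quantile_exists => //.
    by rewrite divr_gt0 ?ltr0n//= ltr_pdivrMr// mul1r ltr_nat.
  near=> n.
  have grid (i : nat) : (i < N)%N -> `|F n (q i) - G (q i)| <= N%:R^-1.
    have : forall i : 'I_N, `|F n (q i) - G (q i)| <= N%:R^-1.
      near: n; apply: filter_forall => j.
      have := FG (q j); move/cvgrPdist_le => /(_ N%:R^-1); rewrite invr_gt0.
      by move=> /(_ N0); apply: filterS => n; rewrite distrC.
    by move=> h iN; exact: (h (Ordinal iN)).
  move=> x; have /andP[Gx0 Gx1] := G01 x; have /andP[Fx0 Fx1] := F01 n x.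
  have NG0 : 0 <= N%:R * G x by rewrite mulr_ge0// ltW.
  have := truncn_itv NG0; set i := Num.truncn _ => /andP[il iu].
  have i_le : i%:R / N%:R <= G x by rewrite ler_pdivrMr// mulrC.
  have i_lt : G x < i.+1%:R / N%:R by rewrite ltr_pdivlMr// mulrC.
  have iN : (i <= N)%N.
    by rewrite -(ler_nat R); apply: le_trans il _; rewrite ler_piMr// ltW.
  (* x lies between the quantiles of levels (i-1)/N and (i+1)/N; the level i-1
     rather than i allows for G x = i/N on an interval. *)
  have upper : F n x <= G x + 2 / N%:R.
    have iS : i.+1%:R / N%:R <= G x + N%:R^-1.
      by rewrite -natr1 mulrDl mul1r lerD2r.
    have [SiN|] := ltnP i.+1 N; last first.
      move=> NSi; apply: le_trans Fx1 _.
      have : 1 <= i.+1%:R / N%:R :> R by rewrite ler_pdivlMr// mul1r ler_nat.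
      have : 0 < N%:R^-1 :> R by rewrite invr_gt0.
      lra.
    have GqE : G (q i.+1) = i.+1%:R / N%:R by apply: qE.
    have xq : x <= q i.+1.
      by rewrite leNgt; apply/negP => /ltW/Gmono; rewrite GqE leNgt i_lt.
    have := Fmono n _ _ xq; have := grid _ SiN; rewrite GqE ler_norml.
    by move=> /andP[_ h1] h2; lra.
  have lower : G x - 3 / N%:R <= F n x.
    have iS : G x < i%:R / N%:R + N%:R^-1 by rewrite -[X in _ + X]mul1r -mulrDl natr1.
    have N1 : 0 < N%:R^-1 :> R by rewrite invr_gt0.
    case: i {il iu i_lt upper} i_le iN iS => [_ _|[_ _|i i_le iN]].
    - by rewrite mul0r add0r; lra.
    - by rewrite mul1r; lra.
    rewrite -natr1 mulrDl mul1r => iS.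
    have SiN : (i.+1 < N)%N by [].
    have GqE : G (q i.+1) = i.+1%:R / N%:R by apply: qE.
    have xq : q i.+1 <= x.
      rewrite leNgt; apply/negP => /ltW/Gmono; rewrite GqE leNgt => /negP; apply.
      by apply: lt_le_trans i_le; rewrite ltr_pM2r// ltr_nat.
    have := Fmono n _ _ xq; have := grid _ SiN; rewrite GqE ler_norml.
    by move=> /andP[h1 _] h2; lra.
  rewrite ler_norml; apply/andP; split; last by lra.
  lra.
have sup_ge0 n : (0 <= ereal_sup [set (`|F n x - G x|)%:E | x in [set: R]])%E.
  apply: (@le_trans _ _ (`|F n 0 - G 0|)%:E); first by rewrite lee_fin.
  by apply: ereal_sup_ubound; exists 0.
have sup_le e : 0 < e -> \forall n \near \oo,
    (ereal_sup [set (`|F n x - G x|)%:E | x in [set: R]] <= e%:E)%E.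
  move=> /unif; apply: filterS => n h; apply: ge_ereal_sup => _ [x _ <-].
  by rewrite lee_fin.
apply/fine_cvgP; split.
  have := sup_le 1 ltr01; apply: filterS => n h.
  by rewrite ge0_fin_numE// (le_lt_trans h)// ltry.
apply/cvgr0Pnorm_le => e e0; have := sup_le e e0; apply: filterS => n h /=.
rewrite ger0_norm ?fine_ge0// -lee_fin fineK//.
by rewrite ge0_fin_numE// (le_lt_trans h)// ltry.
Unshelve. all: by end_near. Qed.

(** * The central limit theorem for arrays with a Gaussian profile *)

(** The average of h under the probability proportional to row n of w. *)
Definition row_avg (R : realType) (w : nat -> nat -> R) (n : nat) (h : nat -> R) : R :=
  (\sum_(k < n.+1) h k * w n k) / \sum_(k < n.+1) w n k.

Definition row_mean (R : realType) (w : nat -> nat -> R) (n : nat) : R :=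
  row_avg w n (fun k => k%:R).

Definition row_sd (R : realType) (w : nat -> nat -> R) (n : nat) : R :=
  Num.sqrt (row_avg w n (fun k => (k%:R - row_mean w n) ^+ 2)).

(** Quotient of two instances of [gaussian_array_sum_cvg]; the scale cancels. *)
Lemma row_avg_cvg (R : realType) (w : nat -> nat -> R) (c s : nat -> R)
    (h : nat -> nat -> R) (H : R -> R) (D x0 : R) :
  gaussian_array w c s ->
  measurable_fun [set: R] H ->
  (\forall n \near \oo, forall k, `|h n k| <= D * (1 + ((k%:R - c n) / s n) ^+ 2)) ->
  (forall t, t != x0 ->
     h n (Num.truncn (c n + s n * t)) @[n --> \oo] --> H t) ->
  row_avg w n (h n) @[n --> \oo] -->
    (\int[lebesgue_measure]_t (H t * gauss t)) / Num.sqrt (2 * pi).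
Proof.
move=> ga mH hD hH; have soo := array_scale ga.
have Z0 : 0 < Num.sqrt (2 * pi) :> R by rewrite sqrtr_gt0 mulr_gt0// pi_gt0.
have total : (s n)^-1 * (\sum_(k < n.+1) 1 * w n k) @[n --> \oo] -->
    Num.sqrt (2 * pi).
  rewrite -integral_gauss0.
  under [X in _ --> X]eq_Rintegral do rewrite -[gauss _]mul1r.
  apply: (gaussian_array_sum_cvg (h := fun _ _ => 1) (D := 1) (x0 := 0) ga) => //.
  - by apply: nearW => n k; rewrite normr1 mul1r lerDl sqr_ge0.
  - by move=> t _; exact: cvg_cst.
have : (s n)^-1 * (\sum_(k < n.+1) h n k * w n k) *
    ((s n)^-1 * (\sum_(k < n.+1) 1 * w n k))^-1 @[n --> \oo] -->
    (\int[lebesgue_measure]_t (H t * gauss t)) / Num.sqrt (2 * pi).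
  apply: cvgM; first exact: (gaussian_array_sum_cvg ga mH hD hH).
  by apply: cvgV => //; exact: lt0r_neq0.
apply: cvg_trans; apply: near_eq_cvg; near=> n.
have s0 : 0 < s n by near: n; move/cvgryPgt: soo; apply.
rewrite /row_avg; under [X in (_ * X)^-1]eq_bigr do rewrite mul1r.
rewrite invfM invrK mulrACA mulVf ?mul1r// gt_eqF//.
Unshelve. all: by end_near. Qed.

Section gaussian_array_limits.
Variables (R : realType) (w : nat -> nat -> R) (c s : nat -> R).
Hypothesis ga : gaussian_array w c s.

Let standard n (k : nat) : R := (k%:R - c n) / s n.

Let lattice t : standard n (Num.truncn (c n + s n * t)) @[n --> \oo] --> t.
Proof. exact: (@lattice_point_cvg R c s t (array_scale ga) (array_center ga t)). Qed.

Let Z0 : Num.sqrt (2 * pi) != 0 :> R.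
Proof. by rewrite gt_eqF// sqrtr_gt0 mulr_gt0// pi_gt0. Qed.

Let first_moment : row_avg w n (standard n) @[n --> \oo] --> (0 : R).
Proof.
rewrite -[X in _ --> X](mul0r (Num.sqrt (2 * pi))^-1) -integral_gauss1.
apply: (@row_avg_cvg R w c s standard (fun t => t) 1 0 ga) => //.
by apply: nearW => n k; rewrite mul1r; exact: normr_le1D_sqr.
Qed.

Let second_moment :
  row_avg w n (fun k => standard n k ^+ 2) @[n --> \oo] --> (1 : R).
Proof.
rewrite -[X in _ --> X](divff Z0) -{1}integral_gauss0 -integral_gauss2.
apply: (@row_avg_cvg R w c s (fun n k => standard n k ^+ 2) (fun t => t ^+ 2) 1 0 ga) => //.
- by apply: nearW => n k; rewrite mul1r ger0_norm ?sqr_ge0// lerDr.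
- move=> t _; rewrite expr2; under eq_fun do rewrite expr2.
  by apply: cvgM; exact: lattice.
Qed.

Let total_neq0 : \forall n \near \oo, 0 < s n /\ \sum_(k < n.+1) w n k != 0.
Proof.
have one : row_avg w n (fun=> 1) @[n --> \oo] --> (1 : R).
  have mass : \int[lebesgue_measure]_t (1 * gauss t) = Num.sqrt (2 * pi) :> R.
    by under eq_Rintegral do rewrite mul1r; exact: integral_gauss0.
  rewrite -[X in _ --> X](divff Z0) -{1}mass.
  apply: (@row_avg_cvg R w c s (fun _ _ => 1) (fun=> 1) 1 0 ga) => //.
  - by apply: nearW => n k; rewrite normr1 mul1r lerDl sqr_ge0.
  - by move=> t _; exact: cvg_cst.
near=> n; split; first by near: n; move/cvgryPgt: (array_scale ga); apply.
have : 0 < row_avg w n (fun=> 1) by near: n; apply: cvgr_gt one _ _.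
by rewrite /row_avg; case: eqVneq => // ->; rewrite invr0 mulr0 ltxx.
Unshelve. all: by end_near. Qed.

Lemma row_mean_cvg : (row_mean w n - c n) / s n @[n --> \oo] --> (0 : R).
Proof.
move: first_moment; apply: cvg_trans; apply: near_eq_cvg; near=> n.
have [s0 t0] : 0 < s n /\ \sum_(k < n.+1) w n k != 0 by near: n; exact: total_neq0.
rewrite /row_mean /row_avg /standard.
under eq_bigr do rewrite mulrAC mulrBl.
rewrite -mulr_suml sumrB -mulr_sumr.
by field; rewrite t0 lt0r_neq0.
Unshelve. all: by end_near. Qed.

(** In standardized units the variance is the second moment minus the squared
    mean, and these tend to 1 and 0. *)
Lemma row_sd_cvg : row_sd w n / s n @[n --> \oo] --> (1 : R).
Proof.
have sq : row_avg w n (fun k => standard n k ^+ 2) - ((row_mean w n - c n) / s n) ^+ 2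
    @[n --> \oo] --> (1 : R).
  rewrite -[X in _ --> X]subr0; apply: cvgB; first exact: second_moment.
  have -> : (0 : R) = 0 * 0 by rewrite mulr0.
  by under eq_fun do rewrite expr2; apply: cvgM; exact: row_mean_cvg.
have : Num.sqrt (row_avg w n (fun k => standard n k ^+ 2) -
    ((row_mean w n - c n) / s n) ^+ 2) @[n --> \oo] --> (1 : R).
  by rewrite -[X in _ --> X]sqrtr1; apply: continuous_cvg; [exact: sqrt_continuous|].
apply: cvg_trans; apply: near_eq_cvg; near=> n.
have [s0 t0] : 0 < s n /\ \sum_(k < n.+1) w n k != 0 by near: n; exact: total_neq0.
set T := row_avg _ _ _ - _.
suff VE : row_avg w n (fun k => (k%:R - row_mean w n) ^+ 2) = s n ^+ 2 * T.
  rewrite /row_sd VE sqrtrM ?sqr_ge0// sqrtr_sqr (ger0_norm (ltW s0)).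
  by rewrite mulrAC divff ?mul1r// lt0r_neq0.
rewrite /T /row_avg /standard.
set m := row_mean w n; set W := \sum_(k < n.+1) w n k in t0 *.
have mE : \sum_(k < n.+1) k%:R * w n k = m * W by rewrite /m /row_mean /row_avg divfK.
have -> : \sum_(k < n.+1) (k%:R - m) ^+ 2 * w n k =
    \sum_(k < n.+1) (k%:R - c n) ^+ 2 * w n k - (m - c n) ^+ 2 * W.
  have -> : (m - c n) ^+ 2 * W =
      2 * (m - c n) * (\sum_(k < n.+1) k%:R * w n k) - (m ^+ 2 - c n ^+ 2) * W.
    by rewrite mE; ring.
  by rewrite /W !mulr_sumr -!sumrB; apply: eq_bigr => k _; ring.
under [in RHS]eq_bigr do rewrite expr_div_n mulrAC.
rewrite -mulr_suml; move: m {mE} (\sum_(k < _) _) => m S.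
by field; rewrite t0 lt0r_neq0.
Unshelve. all: by end_near. Qed.

(** In standardized units the threshold mean + sd x tends to x, so the indicator
    of k <= mean + sd x tends to that of t <= x except at t = x. *)
Lemma row_cdf_cvg (x : R) :
  row_avg w n (fun k => (k%:R <= row_mean w n + row_sd w n * x)%R%:R) @[n --> \oo]
    --> Phi x.
Proof.
have -> : Phi x =
    \int[lebesgue_measure]_t ((t <= x)%R%:R * gauss t) / Num.sqrt (2 * pi).
  by rewrite integral_gauss_Phi mulrAC mulfV// mul1r.
apply: (@row_avg_cvg R w c s
  (fun n k => (k%:R <= row_mean w n + row_sd w n * x)%R%:R)
  (fun t => (t <= x)%R%:R) 1 x ga).
- have -> : (fun t : R => (t <= x)%R%:R) = \1_(`]-oo, x]%classic) :> (R -> R).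
    by apply/funext => t; rewrite indicE; congr (nat_of_bool _)%:R;
       apply/idP/idP; rewrite inE /= in_itv.
  exact: measurable_indic.
- apply: nearW => n k; rewrite mul1r normr_nat.
  by apply: (@le_trans _ _ 1); [rewrite lern1 leq_b1|rewrite lerDl sqr_ge0].
move=> t tx.
have gap : (row_mean w n - c n) / s n + row_sd w n / s n * x -
    standard n (Num.truncn (c n + s n * t)) @[n --> \oo] --> x - t.
  apply: cvgB; last exact: lattice.
  rewrite -[X in _ --> X]add0r -[X in _ --> _ + X]mul1r.
  apply: cvgD; first exact: row_mean_cvg.
  by apply: cvgM; [exact: row_sd_cvg|exact: cvg_cst].
have gapE n : 0 < s n ->
    ((Num.truncn (c n + s n * t))%:R <= row_mean w n + row_sd w n * x) =
    (0 <= (row_mean w n - c n) / s n + row_sd w n / s n * x -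
      standard n (Num.truncn (c n + s n * t))).
  move=> s0; rewrite -[in RHS](pmulr_rge0 _ s0) /standard.
  move: (_%:R) => k; have -> : s n * ((row_mean w n - c n) / s n +
    row_sd w n / s n * x - (k - c n) / s n) = row_mean w n + row_sd w n * x - k.
    by field; exact: lt0r_neq0.
  by rewrite subr_ge0.
have [tlx|xt] := leP t x; apply: cvg_near_cst; near=> n.
  have [s0 _] : 0 < s n /\ \sum_(k < n.+1) w n k != 0 by near: n; exact: total_neq0.
  rewrite gapE// ltW//; near: n; apply: cvgr_gt gap _ _.
  by rewrite subr_gt0 lt_neqAle tx.
have [s0 _] : 0 < s n /\ \sum_(k < n.+1) w n k != 0 by near: n; exact: total_neq0.
rewrite gapE// leNgt (_ : (_ < 0) = true)//; near: n; apply: cvgr_lt gap _ _.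
by rewrite subr_lt0.
Unshelve. all: by end_near. Qed.

End gaussian_array_limits.

(** * The random variables X_n *)

Lemma integral_lattice_law (R : realType) (d : measure_display) (T : measurableType d)
    (P : probability T R) (X : {RV P >-> R}) (n : nat) (p : nat -> R) (f : R -> R) :
  (forall w, exists2 k : nat, (k <= n)%N & X w = k%:R) ->
  (forall k : nat, (k <= n)%N -> P (X @^-1` [set k%:R]) = (p k)%:E) ->
  (\int[P]_w (f (X w))%:E = (\sum_(k < n.+1) f k%:R * p k)%:E)%E.
Proof.
move=> Xk Pk; pose B (k : nat) : set T := X @^-1` [set k%:R].
have mB k : measurable (B k) by exact: measurable_funPTI.
have -> : (fun w => (f (X w))%:E) =
    (fun w => \sum_(k < n.+1) (f k%:R)%:E * (\1_(B k) w)%:E)%E.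
  apply/funext => w; have [j jn Xw] := Xk w.
  rewrite (bigD1 (Ordinal (jn : (j < n.+1)%N)))//= big1 => [|i ij].
    by rewrite adde0 indicE mem_set ?mule1 ?Xw.
  rewrite indicE memNset ?mule0// /B /= Xw => /eqP.
  rewrite eqr_nat => /eqP ji; move: ij => /negP; apply; apply/eqP/val_inj.
  by rewrite /= ji.
rewrite integral_sum//=; last first.
  by move=> k; apply: integrableZl => //; exact: integrable_indic.
rewrite -sumEFin; apply: eq_bigr => k _.
rewrite integralZl//; last exact: integrable_indic.
rewrite integral_indic// setIT EFinM; congr (_ * _)%E.
by apply: Pk; rewrite -ltnS.
Qed.

Lemma sumA_gt0 (R : numFieldType) (n : nat) : 0 < sumA R n.
Proof.
rewrite /sumA; case: n => [|n]; first by rewrite big_ord1 A0.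
rewrite (bigD1 ord_max)//= ltr_wpDr ?A_gt0//=.
by apply: sumr_ge0 => k _; exact: A_ge0.
Qed.

(** Averages do not see the normalization of the row. *)
Lemma row_avg_weight (R : realType) (n : nat) (h : nat -> R) : (100 <= n)%N ->
  row_avg (weight R) n h = \sum_(k < n.+1) h k * (A R n k / sumA R n).
Proof.
move=> n100; have a0 := A_gt0 R (peak_range R n100).
rewrite /row_avg /weight; under eq_bigr do rewrite mulrA.
rewrite -!mulr_suml -/(sumA R n).
under [in RHS]eq_bigr do rewrite mulrA.
rewrite -mulr_suml; have s0 := sumA_gt0 R n.
by field; rewrite !lt0r_neq0.
Qed.

Section law_of_X.
Context (R : realType) (n : nat) (d : measure_display) (T : measurableType d)
  (P : probability T R) (X : {RV P >-> R}).
Hypothesis lawX : has_law_A n X.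

Lemma meanE : mean X = \sum_(k < n.+1) k%:R * (A R n k / sumA R n).
Proof.
rewrite /mean unlock.
by rewrite (@integral_lattice_law _ _ _ _ X n _ (fun x => x) lawX.1 lawX.2).
Qed.

Lemma varianceE_law : fine 'V_P[X] =
  \sum_(k < n.+1) (k%:R - mean X) ^+ 2 * (A R n k / sumA R n).
Proof.
transitivity (fine (\int[P]_w ((X w - mean X) ^+ 2)%:E)%E).
  by rewrite /variance covariance.unlock /mean expectation.unlock; congr fine.
by rewrite (@integral_lattice_law _ _ _ _ X n _ (fun x => (x - mean X) ^+ 2)
  lawX.1 lawX.2).
Qed.

(** For n >= 2 both 1 and n carry positive mass, and the mean cannot equal both. *)
Lemma stddev_gt0 : (2 <= n)%N -> 0 < stddev X.
Proof.
move=> n2; rewrite /stddev sqrtr_gt0 varianceE_law.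
have s0 := sumA_gt0 R n; set m := mean X.
have term_ge0 (k : 'I_n.+1) : 0 <= (k%:R - m) ^+ 2 * (A R n k / sumA R n).
  by rewrite mulr_ge0 ?sqr_ge0// divr_ge0 ?A_ge0// ltW.
have pos (k : nat) : (0 < k <= n)%N -> k%:R != m ->
    0 < \sum_(k < n.+1) (k%:R - m) ^+ 2 * (A R n k / sumA R n).
  move=> /andP[k0 kn] km; rewrite (bigD1 (Ordinal (kn : (k < n.+1)%N)))//=.
  apply: ltr_wpDr; first by apply: sumr_ge0 => i _; exact: term_ge0.
  rewrite mulr_gt0 ?divr_gt0 ?A_gt0 ?k0//.
  by rewrite exprn_even_gt0//= subr_eq0.
have [m1|/pos] := eqVneq 1%:R m; last by apply; lia.
apply: (pos n); first lia.
by rewrite -m1 eqr_nat; lia.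
Qed.

Lemma cdf_normalized (x : R) : (2 <= n)%N ->
  cdf (P := P) (normalized X : {mfun T >-> R}) x =
  (\sum_(k < n.+1) (k%:R <= mean X + stddev X * x)%R%:R * (A R n k / sumA R n))%:E.
Proof.
move=> n2; have s0 := stddev_gt0 n2.
rewrite -(@integral_lattice_law _ _ _ _ X n _
  (fun y => (y <= mean X + stddev X * x)%R%:R) lawX.1 lawX.2).
rewrite /cdf /distribution /pushforward.
rewrite -[_ @^-1` _]setIT -integral_indic//; last first.
  by rewrite -[X in measurable X]setTI; exact: measurable_normalized.
apply: eq_integral => w _; rewrite indicE; congr (_%:R%:E); congr nat_of_bool.
have h : (normalized X w <= x) = (X w <= mean X + stddev X * x).
  by rewrite /normalized ler_pdivrMr// lerBlDl mulrC.
by rewrite -h; apply/idP/idP; rewrite inE /= in_itv.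
Qed.

End law_of_X.

Theorem theorem1p2 (R : realType) (d : nat -> measure_display)
    (T : forall n : nat, measurableType (d n))
    (P : forall n : nat, probability (T n) R)
    (X : forall n : nat, {RV (P n) >-> R})
    (hX : forall n : nat, (1 <= n)%N -> has_law_A n (X n)) :
  let mu := fun n : nat => mean (X n) in
  let sigma := fun n : nat => stddev (X n) in
  [/\ forall n : nat, (2 <= n)%N -> 0 < sigma n,
      cvg_in_distribution (P := P)
        (fun n : nat => normalized (X n) : {mfun T n >-> R})
        (@Phi R)
    & ereal_sup
        [set (`| (sumA R n)^-1 *
                 (\sum_(k < n.+1 | k%:R <= mu n + sigma n * x) A R n k)
                 - Phi x |)%:E | x in [set: R]]
        @[n --> \oo] --> 0%E].
Proof.
move=> mu sigma.
have law n : (100 <= n)%N -> has_law_A n (X n) by move=> n100; apply: hX; lia.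
have muE n : (100 <= n)%N -> mu n = row_mean (weight R) n.
  by move=> n100; rewrite /row_mean row_avg_weight// /mu (meanE (law _ n100)).
have sigmaE n : (100 <= n)%N -> sigma n = row_sd (weight R) n.
  move=> n100; rewrite /row_sd row_avg_weight// /sigma /stddev.
  by rewrite (varianceE_law (law _ n100)) -muE.
have cdfE n x : (100 <= n)%N ->
    row_avg (weight R) n
      (fun k => (k%:R <= row_mean (weight R) n + row_sd (weight R) n * x)%R%:R) =
    \sum_(k < n.+1) (k%:R <= mu n + sigma n * x)%R%:R * (A R n k / sumA R n).
  by move=> n100; rewrite row_avg_weight// muE// sigmaE.
have cdf_cvg x := row_cdf_cvg (gaussian_array_weight R) x.
split.
- by move=> n n2; apply: (stddev_gt0 (n := n)) => //; apply: hX; lia.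
- move=> x _; apply: cvg_EFin.
    near=> n.
    have n100 : (100 <= n)%N by near: n; exact: nbhs_infty_ge.
    by rewrite (cdf_normalized (law _ n100))//; lia.
  move: (cdf_cvg x); apply: cvg_trans; apply: near_eq_cvg; near=> n.
  have n100 : (100 <= n)%N by near: n; exact: nbhs_infty_ge.
  by rewrite /= (cdf_normalized (law _ n100)) ?cdfE//; lia.
- apply: (@polya R (fun n x => (sumA R n)^-1 *
    (\sum_(k < n.+1 | k%:R <= mu n + sigma n * x) A R n k))).
  + move=> n x y xy; rewrite ler_pM2l ?invr_gt0 ?sumA_gt0//.
    rewrite [leLHS]big_mkcond [leRHS]big_mkcond /=; apply: ler_sum => k _.
    case: ifP => [kx|_]; last by case: ifP => // _; exact: A_ge0.
    rewrite ifT// (le_trans kx)// lerD2l ler_wpM2l//; exact: sqrtr_ge0.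
  + move=> n x; have s0 := sumA_gt0 R n; apply/andP; split.
      rewrite mulr_ge0 ?invr_ge0 ?(ltW s0)//.
      by apply: sumr_ge0 => k _; exact: A_ge0.
    rewrite ler_pdivrMl// mulr1 /sumA big_mkcond; apply: ler_sum => k _.
    by case: ifP => // _; exact: A_ge0.
  + exact: Phi_nondecreasing.
  + by move=> x; rewrite Phi_ge0 Phi_le1.
  + exact: continuous_Phi.
  + exact: Phi_cvgNy.
  + exact: Phi_cvgy.
  + move=> x; move: (cdf_cvg x); apply: cvg_trans; apply: near_eq_cvg; near=> n.
    have n100 : (100 <= n)%N by near: n; exact: nbhs_infty_ge.
    rewrite cdfE// mulr_sumr [RHS]big_mkcond /=; apply: eq_bigr => k _.
    by case: (_ <= _); rewrite ?mul0r// mul1r mulrC.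
Unshelve. all: by end_near. Qed.
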